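(* For every $H\in(0,1)\setminus\{\frac12\}$ and every $(a,b)\in\mathbb{R}^2\setminus\{(0,0)\}$, the generalized fractional Brownian motion $(Z_t^H(a,b))_{t\ge0}$ with parameters $a,b,H$ is not a semimartingale.
   Context: For $H\in(0,1)$, a two-sided fractional Brownian motion with Hurst parameter $H$ is a centered Gaussian process $B^H=(B_t^H)_{t\in\mathbb{R}}$ on a probability space $(\Omega,F,\mathbb{P})$ with covariance $\operatorname{Cov}(B_t^H,B_s^H)=\frac12\bigl(|s|^{2H}+|t|^{2H}-|t-s|^{2H}\bigr)$ for $s,t\in\mathbb{R}$. For real $a,b$ with $(a,b)\ne(0,0)$, the generalized fractional Brownian motion (gfBm) with parameters $a,b,H$ is the process $Z^H=(Z_t^H)_{t\ge0}$ defined by $Z_t^H=Z_t^H(a,b)=aB_t^H+bB_{-t}^H$ for $t\ge 0$. Here $Z^H$ is taken with continuous sample paths (a continuous version), and ''semimartingale'' is with respect to the usual augmentation of the natural filtration of $Z^H$. *)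

(* Defs.v *)
From mathcomp Require Import all_boot all_order all_algebra.
From mathcomp Require Import all_classical all_reals all_analysis.

Set Implicit Arguments.
Unset Strict Implicit.
Unset Printing Implicit Defensive.

Import Order.TTheory GRing.Theory Num.Theory.
Import numFieldNormedType.Exports.

Local Open Scope classical_set_scope.
Local Open Scope ring_scope.

(* Processes on [0, +oo[ are families indexed by the whole of R; only the
   values at t >= 0 are ever constrained or used. *)

Section fractional_brownian_motion.
Context d (T : measurableType d) (R : realType) (P : probability T R).

(* Degenerate Gaussian laws (Dirac masses) are included; they are listed
   separately because normal_prob m 0 is not a Dirac mass. *)
Definition gaussian_law (nu : set R -> \bar R) : Prop :=
  exists m : R,
    (forall A : set R, measurable A -> nu A = \d_m A) \/
    (exists2 s : R, 0 < s &
       forall A : set R, measurable A -> nu A = normal_prob m s A).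

Definition gaussian_process (X : R -> {RV P >-> R}) : Prop :=
  forall (n : nat) (t c : 'I_n -> R),
    gaussian_law (pushforward P (fun w => \sum_(i < n) c i * X (t i) w)).

Definition is_fbm (H : R) (B : R -> {RV P >-> R}) : Prop :=
  [/\ gaussian_process B,
      forall t : R, ('E_P[B t] = 0)%E &
      forall t s : R, covariance P (B t) (B s) =
        (2^-1 * (`|s| `^ (2 * H) + `|t| `^ (2 * H) - `|t - s| `^ (2 * H)))%:E].

(* Z is a version of (a B_t + b B_{-t})_{t >= 0}, all of whose sample paths
   are continuous on [0, +oo[. *)
Definition is_gfbm (a b H : R) (Z : R -> {RV P >-> R}) : Prop :=
  (exists2 B : R -> {RV P >-> R}, is_fbm H B &
     forall t : R, 0 <= t ->
       \forall w \ae P, Z t w = a * B t w + b * B (- t) w) /\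
  (forall w : T, {within `[0, +oo[, continuous (fun t : R => Z t w)}).

End fractional_brownian_motion.

Section semimartingales.
Context d (T : measurableType d) (R : realType).
Variables (mu : {measure set T -> \bar R}) (F : R -> set (set T)).

Definition measurable_wrt (G : set (set T)) (Y : T -> R) : Prop :=
  forall A : set R, measurable A -> G (Y @^-1` A).

Definition adapted (X : R -> T -> R) : Prop :=
  forall t : R, 0 <= t -> measurable_wrt (F t) (X t).

Definition cadlag (f : R -> R) : Prop :=
  (forall t : R, 0 <= t -> f x @[x --> t^'+] --> f t) /\
  (forall t : R, 0 < t -> cvg (f x @[x --> t^'-])).

Definition is_cond_exp (G : set (set T)) (X Y : T -> R) : Prop :=
  [/\ measurable_wrt G Y,
      mu.-integrable setT (EFin \o Y) &
      forall A : set T, G A ->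
        (\int[mu]_(w in A) (Y w)%:E = \int[mu]_(w in A) (X w)%:E)%E].

Definition martingale (M : R -> T -> R) : Prop :=
  [/\ adapted M,
      forall t : R, 0 <= t -> mu.-integrable setT (EFin \o M t) &
      forall s t : R, 0 <= s -> s <= t -> is_cond_exp (F s) (M t) (M s)].

Definition stopping_time (tau : T -> \bar R) : Prop :=
  (forall w : T, (0 <= tau w)%E) /\
  (forall t : R, 0 <= t -> F t [set w | (tau w <= t%:E)%E]).

Definition stopped (X : R -> T -> R) (tau : T -> \bar R) : R -> T -> R :=
  fun t w => X (fine (Order.min t%:E (tau w))) w.

Definition local_martingale (M : R -> T -> R) : Prop :=
  [/\ adapted M,
      \forall w \ae mu, cadlag (fun t => M t w) &
      exists tau : nat -> T -> \bar R,
        [/\ forall n : nat, stopping_time (tau n),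
            \forall w \ae mu, (forall n : nat, (tau n w <= tau n.+1 w)%E) /\
                              tau n w @[n --> \oo] --> +oo%E &
            forall n : nat,
              martingale (stopped (fun t w => M t w - M 0 w) (tau n))]].

Definition finite_variation_process (A : R -> T -> R) : Prop :=
  adapted A /\
  \forall w \ae mu, cadlag (fun t => A t w) /\
    forall t : R, 0 <= t -> bounded_variation 0 t (fun u => A u w).

(* The initial value X_0 is absorbed in M or A, which need not vanish at 0. *)
Definition semimartingale (X : R -> T -> R) : Prop :=
  adapted X /\
  exists M A : R -> T -> R,
    [/\ local_martingale M, finite_variation_process A &
        \forall w \ae mu, forall t : R, 0 <= t -> X t w = M t w + A t w].

End semimartingales.

Section natural_filtration.
Context d (T : measurableType d) (R : realType) (P : probability T R).

Definition natural_filtration (X : R -> T -> R) (t : R) : set (set T) :=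
  <<s \bigcup_(s in `[0, t]) g_sigma_algebra_preimage (X s) >>.

Definition usual_augmentation (F : R -> set (set T)) (t : R) : set (set T) :=
  \bigcap_(u in `]t, +oo[) <<s F u `|` P.-negligible >>.

(* P is not assumed complete, and the augmented sigma-algebras contain every
   subset of a P-null event, so martingales are taken on the completion of
   (T, P). For a finite measure, this is what completed_measure_extension P is:
   the outer measure P^* on its Caratheodory-measurable sets. *)
Definition semimartingale_natural (X : R -> T -> R) : Prop :=
  semimartingale (@completed_measure_extension _ T R P)
    (usual_augmentation (natural_filtration X)) X.

End natural_filtration.

(* Main.v *)
(** A semimartingale is a good integrator: along the partitions [1 + k/(n+1)] of
    [1, 2], the elementary integrals of adapted integrands bounded by 1 are
    bounded in probability.  For the finite variation part this is clear; for the
    (stopped) martingale part it is Burkholder's weak type (1,1) inequality for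
    martingale transforms, which holds for martingales that are merely integrable.

    The gfBm violates this.  Adjacent increments [X_k], [X_k+1] of [Z] on [1, 2] have
    variance close to [s^2 = (a^2 + b^2) (n+1)^(-2H)] and correlation close to
    [rho = 2^(2H-1) - 1], the covariance between [B_t] and [B_-t] only contributing
    a second difference of [x^(2H)], hence [O(n^-2)].  As [rho <> 0], integrating
    [sgn rho] times a clamped multiple of the previous increment yields a sum whose
    mean is at least a constant times [n s], which tends to infinity like [n^(1-H)],
    and whose second moment is at most [2 (n s)^2]; by the Paley-Zygmund argument it
    exceeds a multiple of [n s] with probability bounded below. *)
Require Import Defs.
From HB Require Import structures.
From mathcomp Require Import all_boot all_order all_algebra.
From mathcomp Require Import all_classical all_reals all_analysis.
From mathcomp Require Import measurable_realfun ring lra.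
Set Implicit Arguments.
Unset Strict Implicit.
Unset Printing Implicit Defensive.

Import Order.TTheory GRing.Theory Num.Theory.
Import numFieldNormedType.Exports.
Local Open Scope classical_set_scope.
Local Open Scope ring_scope.

(** * Integration against sub-sigma-algebras *)

Section real_integrable.
Context d (T : measurableType d) (R : realType).
Variable mu : {measure set T -> \bar R}.
Implicit Types f g : T -> R.

Local Notation Rintegrable f := (mu.-integrable setT (EFin \o f)).

Lemma RintegrableD f g : Rintegrable f -> Rintegrable g ->
  Rintegrable (fun w => f w + g w).
Proof. by move=> iF ig; exact: (integrableD measurableT iF ig). Qed.

Lemma RintegrableB f g : Rintegrable f -> Rintegrable g ->
  Rintegrable (fun w => f w - g w).
Proof. by move=> iF ig; exact: (integrableB measurableT iF ig). Qed.

Lemma RintegrableZ c f : Rintegrable f -> Rintegrable (fun w => c * f w).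
Proof. by move=> iF; exact: (integrableZl measurableT c iF). Qed.

Lemma Rintegrable_norm f : Rintegrable f -> Rintegrable (fun w => `|f w|).
Proof. by move=> iF; exact: integrable_norm. Qed.

Lemma Rintegrable_sum (I : Type) (s : seq I) (f : I -> T -> R) :
  (forall i, Rintegrable (f i)) -> Rintegrable (fun w => \sum_(i <- s) f i w).
Proof.
move=> iF; elim: s => [|i s IH].
  by under eq_fun do rewrite big_nil; exact: integrable0.
by under eq_fun do rewrite big_cons; exact: RintegrableD.
Qed.

Lemma Rintegral_sum (I : Type) (s : seq I) (f : I -> T -> R) :
  (forall i, Rintegrable (f i)) ->
  \int[mu]_w (\sum_(i <- s) f i w) = \sum_(i <- s) \int[mu]_w f i w.
Proof.
move=> iF; elim: s => [|i s IH].
  by under eq_Rintegral do rewrite big_nil; rewrite big_nil /Rintegral integral0.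
under eq_Rintegral do rewrite big_cons.
by rewrite big_cons RintegralD// ?IH//; exact: Rintegrable_sum.
Qed.

Lemma Rintegrable_bounded_mul c f g : measurable_fun setT f ->
  (forall w, `|f w| <= c) -> Rintegrable g -> Rintegrable (fun w => f w * g w).
Proof.
move=> mf fc ig; apply: (@integrableMr _ _ _ mu setT measurableT f (EFin \o g)) => //.
by exists c; split; rewrite ?num_real// => x cx w _ /=; rewrite (le_trans (fc w))// ltW.
Qed.

Lemma le_Rintegrable f g : measurable_fun setT f ->
  (forall w, `|f w| <= g w) -> Rintegrable g -> Rintegrable f.
Proof.
move=> mf fg ig; apply: (le_integrable measurableT _ _ ig).
  exact/measurable_EFinP.
by move=> w _ /=; rewrite lee_fin (le_trans (fg w))// ler_norm.
Qed.

Lemma Rintegrable_cst c : (mu setT < +oo)%E -> Rintegrable (fun=> c).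
Proof.
move=> fin; apply: measurable_bounded_integrable => //.
by exists `|c|; split; rewrite ?num_real// => x cx w _ /=; exact: ltW.
Qed.

Lemma Rintegrable_indic A : (mu setT < +oo)%E -> measurable A ->
  Rintegrable (\1_A : T -> R).
Proof.
move=> fin mA; apply: le_Rintegrable (Rintegrable_cst 1 fin) => // w.
by rewrite indicE ger0_norm// lern1 leq_b1.
Qed.

(** The pointwise bound [|x y| <= 1 + x^4 + y^4] suffices on a finite measure space. Fourth moments
    are what Gaussian laws supply below. *)
Lemma Rintegrable_pow4_mul f g : (mu setT < +oo)%E ->
  measurable_fun setT f -> measurable_fun setT g ->
  Rintegrable (fun w => f w ^+ 4) -> Rintegrable (fun w => g w ^+ 4) ->
  Rintegrable (fun w => f w * g w).
Proof.
move=> fin mf mg if4 ig4.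
apply: (@le_Rintegrable _ (fun w => 1 + (f w ^+ 4 + g w ^+ 4))).
- exact: measurable_funM.
- move=> w; move: (f w) (g w) => x y; rewrite ler_norml.
  have := sqr_ge0 (x + y); have := sqr_ge0 (x - y).
  have := sqr_ge0 (x ^+ 2 - 1); have := sqr_ge0 (y ^+ 2 - 1).
  have := sqr_ge0 (x ^+ 2); have := sqr_ge0 (y ^+ 2).
  by move=> *; apply/andP; split; nra.
- by apply: RintegrableD; [exact: Rintegrable_cst|exact: RintegrableD].
Qed.

End real_integrable.

Section sub_sigma_algebra.
Context d (T : measurableType d) (R : realType).
Implicit Types (G : set (set T)) (f g : T -> R).

(** Moving [G] into the type of the domain makes the closure rules of [measurable_fun] available for
    sub-sigma-algebras. *)
Lemma measurable_wrtP G f : sigma_algebra setT G ->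
  measurable_wrt G f <-> measurable_fun setT (f : g_sigma_algebraType G -> R).
Proof.
move=> sG; have EG : (<<s G >> : set (set T)) = G by exact: sigma_algebra_id.
split => mf.
- move=> _ Y mY; rewrite setTI.
  have : G (f @^-1` Y) by exact: mf.
  by rewrite -{1}EG.
- move=> Y mY; rewrite -EG.
  by have := mf measurableT _ mY; rewrite setTI.
Qed.

Lemma measurable_wrt_measurable G f : G `<=` measurable ->
  measurable_wrt G f -> measurable_fun setT f.
Proof. by move=> Gm mf _ Y mY; rewrite setTI; exact/Gm/mf. Qed.

Lemma measurable_wrtS G G' f : G `<=` G' ->
  measurable_wrt G f -> measurable_wrt G' f.
Proof. by move=> GG' mf A mA; exact/GG'/mf. Qed.

End sub_sigma_algebra.

(** * Uniform approximation by step functions *)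

Section staircase.
Context {R : realType}.

(* On [0, m e] this approximates [x] within [e], while integrating
   [staircase e m (phi w)] only involves the sets [phi >= j e]. *)
Definition staircase (e : R) (m : nat) (x : R) : R :=
  \sum_(j < m) e * (j.+1%:R * e <= x)%R%:R.

Lemma staircase_approx (e : R) (m : nat) (x : R) : 0 < e -> 0 <= x ->
  x <= m%:R * e -> 0 <= x - staircase e m x <= e.
Proof.
move=> e0 x0 xm.
(* The bound [x <= m e] is not inherited by smaller [m], so the induction runs on estimates
   truncated by [Num.min], which hold for every [x >= 0]. *)
suff : staircase e m x <= Num.min x (m%:R * e) /\
    Num.min x (m%:R * e + e) - e <= staircase e m x.
  by rewrite !min_l//; [move=> -[? ?]; apply/andP; split; lra|lra].
elim: m {xm} => [|m [IH1 IH2]].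
  rewrite /staircase big_ord0 mul0r add0r min_r//.
  by have [?|?] := lerP x e; split; lra.
have -> : staircase e m.+1 x = staircase e m x + e * (m.+1%:R * e <= x)%R%:R.
  by rewrite /staircase big_ord_recr.
move: IH1 IH2; rewrite -natr1 mulrDl mul1r.
have [H|H] := lerP (m%:R * e + e) x => /=.
  have me : m%:R * e <= x by lra.
  rewrite mulr1 (min_r me) => ? ?.
  by have [?|?] := lerP x (m%:R * e + e + e); split; lra.
rewrite mulr0 addr0 => H1 H2.
have H3 : x <= m%:R * e + e + e by lra.
rewrite (min_l H3); split; last by lra.
by rewrite (le_trans H1)// ge_min lexx.
Qed.

End staircase.

Section orthogonality.
Context d (T : measurableType d) (R : realType).
Variable mu : {measure set T -> \bar R}.
Variable G : set (set T).
Hypotheses (Gmeas : G `<=` measurable).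

Let Rintegral_staircase (D phi : T -> R) (e : R) m :
  mu.-integrable setT (EFin \o D) ->
  (forall A, G A -> \int[mu]_(w in A) D w = 0) ->
  measurable_wrt G phi ->
  mu.-integrable setT (EFin \o (fun w => staircase e m (phi w) * D w)) /\
  \int[mu]_w (staircase e m (phi w) * D w) = 0.
Proof.
move=> iD D0 mphi.
elim: m => [|m [IHi IH0]].
  have E : (fun w => staircase e 0 (phi w) * D w) = cst 0.
    by apply/funext => w; rewrite /staircase big_ord0 mul0r.
  rewrite E; split; first exact: integrable0.
  by rewrite /Rintegral integral0.
set A := phi @^-1` `[m.+1%:R * e, +oo[.
have GA : G A by exact: mphi.
have mA : measurable A by exact: Gmeas.
have E w : staircase e m.+1 (phi w) * D w =
    staircase e m (phi w) * D w + e * (D \_ A) w.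
  rewrite /staircase big_ord_recr/= mulrDl; congr (_ + _).
  rewrite patchE; case: ifPn => [/set_mem|/negP wA].
    by rewrite /A/= in_itv/= andbT => ->; rewrite mulr1.
  have -> : (m.+1%:R * e <= phi w) = false.
    by apply/negP => H; apply/wA/mem_set; rewrite /A/= in_itv/= andbT.
  by rewrite !mulr0 mul0r.
have iDA : mu.-integrable setT (EFin \o (fun w => (D \_ A) w)).
  have /integrable_mkcond : mu.-integrable A (EFin \o D) by exact: integrableS iD.
  by rewrite restrict_EFin; exact.
have ieDA : mu.-integrable setT (EFin \o (fun w => e * (D \_ A) w)).
  exact: (integrableZl measurableT e iDA).
have -> : (fun w => staircase e m.+1 (phi w) * D w) =
   (fun w => staircase e m (phi w) * D w + e * (D \_ A) w).
  by apply/funext => w; rewrite E.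
split; first exact: (integrableD measurableT IHi ieDA).
rewrite RintegralD// IH0 add0r RintegralZl// -Rintegral_mkcond D0//.
by rewrite mulr0.
Qed.

(** Orthogonality to the indicators of [G] passes to step functions of [phi], then to [phi] by
    uniform approximation, the error being at most the mesh times the integral of [|D|]. For a
    martingale increment [D], this removes the linear terms in Burkholder's argument. *)
Lemma Rintegral_bounded_mul_eq0 (D phi : T -> R) (c : R) :
  mu.-integrable setT (EFin \o D) ->
  sigma_algebra setT G ->
  (forall A, G A -> \int[mu]_(w in A) D w = 0) ->
  measurable_wrt G phi -> (forall w, `|phi w| <= c) ->
  mu.-integrable setT (EFin \o (fun w => phi w * D w)) /\
  \int[mu]_w (phi w * D w) = 0.
Proof.
move=> iD sG D0 mphi phic.
have mphi' := measurable_wrt_measurable Gmeas mphi.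
have iphiD : mu.-integrable setT (EFin \o (fun w => phi w * D w)).
  exact: Rintegrable_bounded_mul phic _.
split=> //.
have c0 : 0 <= c by rewrite (le_trans _ (phic point)).
have mpsi : measurable_wrt G (fun w => phi w + c).
  apply/measurable_wrtP => //; apply: measurable_funD => //.
  exact/measurable_wrtP.
have psi0 w : 0 <= phi w + c by have := phic w; rewrite ler_norml => /andP[]; lra.
have psic w : phi w + c <= 2 * c by have := phic w; rewrite ler_norml => /andP[]; lra.
(* The shift makes the multiplier nonnegative; it changes nothing because [D] integrates to 0 over
   [setT], a member of [G]. *)
have ->: \int[mu]_w (phi w * D w) = \int[mu]_w ((phi w + c) * D w).
  under [RHS]eq_Rintegral do rewrite mulrDl.
  rewrite RintegralD//; last exact: (integrableZl measurableT c iD).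
  rewrite RintegralZl// D0 ?mulr0 ?addr0//.
  case: sG => G0 GD _.
  by rewrite -(setD0 setT); exact: GD.
set I := \int[mu]_w ((phi w + c) * D w).
have ipsiD : mu.-integrable setT (EFin \o (fun w => (phi w + c) * D w)).
  have -> : (fun w => (phi w + c) * D w) = (fun w => phi w * D w + c * D w).
    by apply/funext => w; rewrite mulrDl.
  by apply: RintegrableD => //; exact: RintegrableZ.
set K := \int[mu]_w `|D w|.
have K0 : 0 <= K by apply: Rintegral_ge0.
have iaD : mu.-integrable setT (EFin \o (fun w => `|D w|)).
  exact: integrable_norm.
have key m : `|I| <= (2 * c + 1) / m.+1%:R * K.
  (* With this mesh, [m.+1] steps reach [2 c + 1], above the supremum of [phi + c]; the added 1
     keeps [e] positive when [c = 0]. *)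
  set e := (2 * c + 1) / m.+1%:R.
  have e0 : 0 < e by rewrite divr_gt0// ltr_wpDl// mulr_ge0.
  have [iS S0] := Rintegral_staircase e m.+1 iD D0 mpsi.
  have -> : I = \int[mu]_w (((phi w + c) - staircase e m.+1 (phi w + c)) * D w).
    rewrite -[LHS]subr0 -[X in _ - X = _]S0 -RintegralB//.
    by apply: eq_Rintegral => w _; rewrite mulrBl.
  have iB : mu.-integrable setT (EFin \o (fun w =>
      ((phi w + c) - staircase e m.+1 (phi w + c)) * D w)).
    rewrite (_ : (fun w => _) = (fun w => (phi w + c) * D w
       - staircase e m.+1 (phi w + c) * D w)); last first.
      by apply/funext => w; rewrite mulrBl.
    exact: RintegrableB.
  rewrite (le_trans (le_normr_Rintegral _ _))// -RintegralZl//.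
  apply: le_Rintegral => //.
  - exact: integrable_norm.
  - exact: (integrableZl measurableT e iaD).
  - move=> w _; rewrite normrM ler_wpM2r//.
    have psie : phi w + c <= m.+1%:R * e.
      by apply: le_trans (psic w) _; rewrite /e mulrCA divff// mulr1; lra.
    have /andP[h0 h1] := staircase_approx e0 (psi0 w) psie.
    by rewrite ger0_norm.
apply/eqP; rewrite -normr_le0; apply/ler_addgt0Pl => x x0; rewrite addr0.
have [m] : exists m : nat, (2 * c + 1) * K / x < m.+1%:R.
  exists (Num.truncn ((2 * c + 1) * K / x)).
  exact: truncnS_gt.
rewrite ltr_pdivrMr// => H; apply: (le_trans (key m)).
by rewrite mulrAC ler_pdivrMr// mulrC [x * _]mulrC mulrC ltW.
Qed.

End orthogonality.

(** * Burkholder's function for the weak type inequality *)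

Section burkholder_function.
Context {R : realType}.
Implicit Types x y h k : R.

(* It majorizes [1_{|y| >= 1} - 2 |x|] and is concave along the segments on
   which [|y|] varies at most as much as [|x|]; [(burkholderUx, burkholderUy)] is
   a supergradient in these directions. *)
Definition burkholderU x y : R :=
  if `|x| + `|y| <= 1 then y ^+ 2 - x ^+ 2 else 1 - 2 * `|x|.

Definition burkholderUx x y : R :=
  if `|x| + `|y| <= 1 then - 2 * x else - 2 * Num.sg x.

Definition burkholderUy x y : R :=
  if `|x| + `|y| <= 1 then 2 * y else 0.

(** Within the diamond [|x| + |y| <= 1], the remainder of the quadratic [y^2 - x^2] is
    [k^2 - h^2 <= 0]; outside, the function is concave in [x] alone. Entering the diamond reduces to
    the outer case, since there [(y + k)^2 <= (1 - |x + h|)^2]. Leaving it is the delicate case. *)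
Lemma burkholderU_supergradient x y h k : `|k| <= `|h| ->
  burkholderU (x + h) (y + k) <=
  burkholderU x y + burkholderUx x y * h + burkholderUy x y * k.
Proof.
rewrite /burkholderU /burkholderUx /burkholderUy => kh.
have k2h2 : k ^+ 2 <= h ^+ 2.
  by rewrite -(real_normK (num_real k)) -(real_normK (num_real h)) lerXn2r ?nnegrE.
have [D|/negbTE nD] := boolP (`|x| + `|y| <= 1); last first.
  have sgx : - 2 * `|x + h| <= - 2 * `|x| - 2 * Num.sg x * h.
    have : Num.sg x * (x + h) <= `|x + h|.
      rewrite (le_trans (ler_norm _))// normrM normr_sg.
      by case: (x != 0); rewrite ?mul1r ?mul0r.
    by rewrite mulrDr -normrEsg; nra.
  case: ifP => [D'|_]; last by lra.
  suff : (y + k) ^+ 2 <= (1 - `|x + h|) ^+ 2.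
    by have := real_normK (num_real (x + h)); nra.
  rewrite -(real_normK (num_real (y + k))) lerXn2r ?nnegrE//;
    have := normr_ge0 (y + k); lra.
case: ifP => [_|/negbT]; first by nra.
rewrite -ltNge => nD'.
(* On leaving the diamond, the claim amounts to [(1 - |x + h|)^2 <= (y + k)^2 + h^2 - k^2], which is
   immediate in the first case. *)
have [E|E] := lerP (`|1 - `|x + h| |) (`|y + k|).
  have : `|1 - `|x + h| | ^+ 2 <= `|y + k| ^+ 2 by rewrite lerXn2r ?nnegrE.
  rewrite !real_normK ?num_real//; have := real_normK (num_real (x + h)); nra.
have {}E : `|y + k| < `|x + h| - 1.
  by move: E; case: (ger0P (1 - `|x + h|)) => ? ?; lra.
have Hx : `|x| <= `|x + h| by have := normr_ge0 (y + k); have := normr_ge0 y; lra.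
have Hk : `|y| <= `|y + k| + `|h|.
  by rewrite -{1}(addrK k y) (le_trans (ler_normB _ _))// lerD2l.
have Hyk : - `|y| * `|h| <= y * k.
  by rewrite mulNr lerNl (le_trans (ler_norm _))// normrN normrM ler_wpM2l.
have [x0|x0] := lerP 0 (x + h).
  rewrite (ger0_norm x0) in E Hx *.
  have xl := ler_norm x.
  have h0 : 0 <= h by lra.
  rewrite (ger0_norm h0) in Hk Hyk.
  (* The product of the factors in [P1] and [P2] is [(h - |y|)^2 - (x + h - 1)^2]; with
     [y k >= - |y| h] its sign gives the claim. The case [x + h < 0] is the mirror image. *)
  have P1 : 0 <= 1 - x - `|y| by lra.
  have P2 : 0 <= 2 * h - 1 + x - `|y| by lra.
  have := mulr_ge0 P1 P2; have := real_normK (num_real y); nra.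
rewrite (ltr0_norm x0) in E Hx *.
have xl : - x <= `|x| by rewrite -normrN ler_norm.
have h0 : h <= 0 by lra.
rewrite (ler0_norm h0) in Hk Hyk.
have P1 : 0 <= 1 + x - `|y| by lra.
have P2 : 0 <= - 2 * h - 1 - x - `|y| by lra.
have := mulr_ge0 P1 P2; have := real_normK (num_real y); nra.
Qed.

Lemma burkholderU_y0_le0 x : burkholderU x 0 <= 0.
Proof.
rewrite /burkholderU normr0 addr0 expr0n/= sub0r; case: ifP => [_|/negbT].
  by rewrite oppr_le0 sqr_ge0.
by rewrite -ltNge; lra.
Qed.

Lemma le_burkholderU x y : (1 <= `|y|)%R%:R - 2 * `|x| <= burkholderU x y.
Proof.
have x0 := normr_ge0 x; rewrite /burkholderU; case: ifP => [D|_]; last first.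
  by rewrite lerB// lern1 leq_b1.
rewrite -(real_normK (num_real y)) -(real_normK (num_real x)).
have y0 := normr_ge0 y; case: (lerP 1 `|y|) => /= y1.
  have -> : `|x| = 0 by lra.
  by rewrite expr0n/=; nra.
have x1 : 0 <= 1 - `|x| by lra.
by have := mulr_ge0 x0 x1; have := sqr_ge0 `|y|; lra.
Qed.

Lemma burkholderU_bound x y : `|burkholderU x y| <= 1 + 2 * `|x|.
Proof.
have x0 := normr_ge0 x; have y0 := normr_ge0 y.
rewrite /burkholderU ler_norml; case: ifP => [D|_]; last by apply/andP; split; lra.
rewrite -(real_normK (num_real y)) -(real_normK (num_real x)).
have x1 : 0 <= 1 - `|x| by lra.
have y1 : 0 <= 1 - `|y| by lra.
have := mulr_ge0 x0 x1; have := mulr_ge0 y0 y1.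
have := sqr_ge0 `|y|; have := sqr_ge0 `|x|.
by move=> *; apply/andP; split; lra.
Qed.

Lemma burkholderUx_bound x y : `|burkholderUx x y| <= 2.
Proof.
rewrite /burkholderUx; case: ifP => [D|_].
  by rewrite normrM normrN normr_nat; have := normr_ge0 y; lra.
rewrite normrM normr_sg normrN normr_nat.
by rewrite -[leRHS]mulr1 ler_wpM2l// lern1 leq_b1.
Qed.

Lemma burkholderUy_bound x y : `|burkholderUy x y| <= 2.
Proof.
rewrite /burkholderUy; case: ifP => [D|_]; last by rewrite normr0.
by rewrite normrM normr_nat; have := normr_ge0 x; lra.
Qed.

End burkholder_function.

(** * The weak type (1,1) inequality for martingale transforms *)

Section measurable_burkholder.
Context d (T : measurableType d) (R : realType).
Variables f g : T -> R.
Hypotheses (mf : measurable_fun setT f) (mg : measurable_fun setT g).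

Let measurable_diamond : measurable_fun setT (fun w => `|f w| + `|g w| <= 1).
Proof.
apply: measurable_fun_ler => //; apply: measurable_funD; exact: measurableT_comp.
Qed.

Lemma measurable_burkholderU :
  measurable_fun setT (fun w => burkholderU (f w) (g w)).
Proof.
apply: measurable_fun_ifT => //.
  by apply: measurable_funB; exact: measurable_funX.
apply: measurable_funB => //; apply: measurable_funM => //.
exact: measurableT_comp.
Qed.

Lemma measurable_burkholderUx :
  measurable_fun setT (fun w => burkholderUx (f w) (g w)).
Proof.
apply: measurable_fun_ifT => //; apply: measurable_funM => //.
rewrite (_ : (fun w => Num.sg (f w)) =
  (fun w => if f w == 0 then 0 else if f w < 0 then - 1 else 1))//.
apply: measurable_fun_ifT => //; first exact: measurable_fun_eqr.
by apply: measurable_fun_ifT => //; exact: measurable_fun_ltr.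
Qed.

Lemma measurable_burkholderUy :
  measurable_fun setT (fun w => burkholderUy (f w) (g w)).
Proof.
by apply: measurable_fun_ifT => //; exact: measurable_funM.
Qed.

End measurable_burkholder.

Section weak_type.
Context d (T : measurableType d) (R : realType).
Variable mu : {measure set T -> \bar R}.
Variables (F : nat -> set (set T)) (M eta : nat -> T -> R).
Hypotheses (mufin : (mu setT < +oo)%E)
  (sF : forall k, sigma_algebra setT (F k))
  (Fmeas : forall k, F k `<=` measurable)
  (F_nd : forall k, F k `<=` F k.+1)
  (aM : forall k, measurable_wrt (F k) (M k))
  (iM : forall k, mu.-integrable setT (EFin \o M k))
  (martM : forall k A, F k A ->
    \int[mu]_(w in A) M k.+1 w = \int[mu]_(w in A) M k w)
  (aeta : forall k, measurable_wrt (F k) (eta k))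
  (eta_le1 : forall k w, `|eta k w| <= 1).

Definition transform n w := \sum_(k < n) eta k w * (M k.+1 w - M k w).

Let transformS n w :
  transform n.+1 w = transform n w + eta n w * (M n.+1 w - M n w).
Proof. by rewrite /transform big_ord_recr. Qed.

Lemma measurable_wrt_transform n : measurable_wrt (F n) (transform n).
Proof.
elim: n => [|n IH].
  rewrite (_ : transform 0 = cst 0); last first.
    by apply/funext => w; rewrite /transform big_ord0.
  by apply/measurable_wrtP => //; exact: measurable_cst.
rewrite (_ : transform n.+1 =
    (fun w => transform n w + eta n w * (M n.+1 w - M n w))); last first.
  by apply/funext => w; rewrite transformS.
apply/measurable_wrtP => //.
have up f : measurable_wrt (F n) f ->
    measurable_fun setT (f : g_sigma_algebraType (F n.+1) -> R).
  by move=> mf; apply/measurable_wrtP => //; exact: measurable_wrtS mf.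
apply: measurable_funD; first exact: up.
apply: measurable_funM; first exact: up.
by apply: measurable_funB; [exact/measurable_wrtP|exact: up].
Qed.

Variable l : R.
Hypothesis l0 : 0 < l.

Let V n w := burkholderU (M n w / l) (transform n w / l).

Let mV n : measurable_fun setT (V n).
Proof.
have mM : measurable_fun setT (M n).
  exact: (measurable_wrt_measurable (@Fmeas n)).
have mN : measurable_fun setT (transform n).
  exact: (measurable_wrt_measurable (@Fmeas n) (@measurable_wrt_transform n)).
by apply: measurable_burkholderU; exact: measurable_funM.
Qed.

Let Vbound n w : `|V n w| <= 1 + 2 / l * `|M n w|.
Proof.
rewrite (le_trans (burkholderU_bound _ _))// normrM normfV (gtr0_norm l0).
by rewrite mulrA mulrAC.
Qed.

Let iV n : mu.-integrable setT (EFin \o V n).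
Proof.
apply: le_Rintegrable (Vbound n) _ => //.
apply: RintegrableD; first exact: Rintegrable_cst.
by apply: RintegrableZ; exact: Rintegrable_norm.
Qed.

(** The supergradient inequality is integrated with [h = D / l] and [k = eta D / l], which is
    allowed as [|eta| <= 1]. Its linear term is the increment [D] times a bounded function
    measurable at time [n], so it has integral 0. *)
Let V_dec n : \int[mu]_w V n.+1 w <= \int[mu]_w V n w.
Proof.
pose phi w := burkholderUx (M n w / l) (transform n w / l) +
              burkholderUy (M n w / l) (transform n w / l) * eta n w.
pose D w := M n.+1 w - M n w.
have iD : mu.-integrable setT (EFin \o D) by exact: RintegrableB.
have mphi : measurable_wrt (F n) phi.
  apply/measurable_wrtP => //.
  have mMn : measurable_fun setT (fun w : g_sigma_algebraType (F n) => M n w / l).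
    by apply: measurable_funM => //; exact/measurable_wrtP.
  have mNn : measurable_fun setT
      (fun w : g_sigma_algebraType (F n) => transform n w / l).
    by apply: measurable_funM => //; exact/measurable_wrtP/measurable_wrt_transform.
  apply: measurable_funD; first exact: measurable_burkholderUx.
  by apply: measurable_funM; [exact: measurable_burkholderUy|exact/measurable_wrtP].
have phi4 w : `|phi w| <= 4.
  rewrite (le_trans (ler_normD _ _))// normrM.
  have -> : 4 = 2 + 2 * 1 :> R by lra.
  apply: lerD; first exact: burkholderUx_bound.
  by apply: ler_pM => //; exact: burkholderUy_bound.
have D0 A : F n A -> \int[mu]_(w in A) D w = 0.
  move=> FA; have mA := Fmeas FA.
  have iA k : mu.-integrable A (EFin \o M k) by exact: integrableS (iM k).
  by rewrite /D RintegralB// martM// subrr.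
have [ipD pD0] := Rintegral_bounded_mul_eq0 (@Fmeas n) iD (sF n) D0 mphi phi4.
rewrite -[leRHS]addr0 -[X in _ + X](mulr0 l^-1) -pD0 -RintegralZl//.
rewrite -RintegralD//; last exact: RintegrableZ.
apply: le_Rintegral => //.
  by apply: RintegrableD => //; exact: RintegrableZ.
move=> w _; rewrite /V transformS.
have -> : M n.+1 w / l = M n w / l + D w / l by rewrite -mulrDl /D addrC subrK.
have -> : (transform n w + eta n w * (M n.+1 w - M n w)) / l =
    transform n w / l + eta n w * (D w / l) by rewrite mulrDl -mulrA.
apply: le_trans (burkholderU_supergradient _ _ _) _.
  by rewrite normrM -[leRHS]mul1r ler_wpM2r.
rewrite -addrA lerD2l le_eqVlt; apply/orP; left; apply/eqP.
by rewrite /phi /D; ring.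
Qed.

(** The mean of [V 0] is nonpositive because the transform starts at 0, and the means decrease.
    Hence [V n] has nonpositive mean, while it majorizes the indicator of the event minus
    [2 / l * |M n|]. *)
Theorem burkholder_weak_type n :
  (mu [set w | (l <= `|transform n w|)%R] <= (2 / l * \int[mu]_w `|M n w|)%:E)%E.
Proof.
have mN : measurable_fun setT (transform n).
  exact: (measurable_wrt_measurable (@Fmeas n) (@measurable_wrt_transform n)).
set E := [set w | _].
have mE : measurable E.
  rewrite /E -[X in measurable X]setTI.
  have mN' : measurable_fun setT (fun w => l <= `|transform n w|).
    by apply: measurable_fun_ler => //; exact: measurableT_comp.
  have := mN' measurableT [set true] I; rewrite setTI.
  by rewrite (_ : _ @^-1` _ = E)// setTI.
have V0 : \int[mu]_w V 0 w <= 0.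
  rewrite -oppr_ge0 -mulN1r -RintegralZl//.
  apply: Rintegral_ge0 => w _; rewrite mulN1r oppr_ge0 /V /transform big_ord0 mul0r.
  exact: burkholderU_y0_le0.
have Vn : \int[mu]_w V n w <= 0.
  by elim: n {mN E mE} => // n IH; exact: le_trans (V_dec n) IH.
have Efin : (mu E < +oo)%E by rewrite (le_lt_trans _ mufin)// le_measure ?inE.
have iE : mu.-integrable setT (EFin \o \1_E).
  exact: Rintegrable_indic.
have -> : mu E = (\int[mu]_w \1_E w)%:E.
  rewrite /Rintegral integral_indic// setIT fineK// ge0_fin_numE//.
rewrite lee_fin.
have iaM := Rintegrable_norm (iM n).
suff : \int[mu]_w \1_E w <= \int[mu]_w (V n w + 2 / l * `|M n w|).
  by rewrite RintegralD ?RintegralZl//; [lra|exact: RintegrableZ].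
apply: le_Rintegral => //; first by apply: RintegrableD => //; exact: RintegrableZ.
move=> w _; have := le_burkholderU (M n w / l) (transform n w / l).
rewrite -/(V n w) !normrM normfV (gtr0_norm l0) ler_pdivlMr// mul1r.
have -> : (l <= `|transform n w|)%R%:R = \1_E w :> R.
  rewrite indicE; congr (nat_of_bool _)%:R; apply/idP/idP => [H|/set_mem//].
  by rewrite mem_set.
by rewrite [_ / l]mulrC mulrA; lra.
Qed.

End weak_type.

(** * Semimartingales are good integrators *)

Section grid.
Context {R : realType}.

(* The interval [1, 2] is cut into [n.+1] pieces; it stays away from 0, where the
   covariance between [B_t] and [B_{-s}] is singular. *)
Definition grid (n k : nat) : R := 1 + k%:R / n.+1%:R.

Lemma grid0 n : grid n 0 = 1.
Proof. by rewrite /grid mul0r addr0. Qed.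

Lemma gridnn n : grid n n.+1 = 2.
Proof. by rewrite /grid divff// -natr1. Qed.

Lemma grid_lt n k : grid n k < grid n k.+1.
Proof. by rewrite /grid ltrD2l ltr_pM2r ?invr_gt0// ltr_nat. Qed.

Lemma grid_ge1 n k : 1 <= grid n k.
Proof. by rewrite /grid lerDl divr_ge0. Qed.

Lemma grid_ge0 n k : 0 <= grid n k.
Proof. exact: le_trans (grid_ge1 n k). Qed.

Lemma grid_le2 n k : (k <= n.+1)%N -> grid n k <= 2.
Proof.
move=> kn; rewrite -(gridnn n) /grid lerD2l ler_pM2r ?invr_gt0//.
by rewrite ler_nat.
Qed.

Lemma bounded_variation_grid (f : R -> R) : bounded_variation 0 2 f ->
  exists v, forall n, \sum_(k < n.+1) `|f (grid n k.+1) - f (grid n k)| <= v.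
Proof.
move=> bvf.
have [v vub] : bounded_variation 1 2 f by apply: bounded_variationr bvf; lra.
exists v => n.
(* The left endpoint 1 is left out, as [variation] prepends it. *)
pose s := [seq grid n k.+1 | k <- iota 0 n.+1].
have szs : size s = n.+1 by rewrite size_map size_iota.
have nths x k : (k <= n.+1)%N -> nth x (1 :: s) k = grid n k.
  case: k => [|k] kn /=; first by rewrite grid0.
  by rewrite (nth_map 0%N) ?size_iota// nth_iota.
have -> : \sum_(k < n.+1) `|f (grid n k.+1) - f (grid n k)| = variation 1 2 f s.
  rewrite /variation szs big_mkord; apply: eq_bigr => k _.
  by rewrite /= -[nth 2 s k]/(nth 2 (1 :: s) k.+1) !nths// ltnW.
apply/vub/variations_variation; split.
  rewrite -(grid0 n) /s; elim: n.+1 0%N => //= m IH j.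
  by rewrite grid_lt IH.
by rewrite -nth_last szs -[nth 1 s n]/(nth 1 (1 :: s) n.+1) nths// gridnn.
Qed.

End grid.

Section eventually_small.
Context d (T : measurableType d) (R : realType).
Variable mu : {measure set T -> \bar R}.

(** The limit superior of the events is null, and by finiteness of [mu] the measures of the tail
    unions decrease to its measure. This turns almost sure statements into uniform ones off a small
    event. *)
Lemma ae_eventually_notin_small (E : nat -> set T) (e : R) :
  (mu setT < +oo)%E -> (forall n, measurable (E n)) ->
  (\forall w \ae mu, \forall n \near \oo, ~ E n w) -> 0 < e ->
  exists n, (mu (E n) < e%:E)%E.
Proof.
move=> fin mE aeE e0.
have mU n : measurable (\bigcup_(k in [set k | (n <= k)%N]) E k).
  exact: bigcup_measurable.
have := lim_sup_set_cvg mu E mE.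
have -> : mu (lim_sup_set E) = 0.
  have mL : measurable (lim_sup_set E).
    by apply: bigcap_measurable => // n _; exact: mU.
  apply/(negligibleP mu mL); apply: negligibleS aeE => w Lw /= [N _ NE].
  by have [k /= Nk Ek] := Lw N I; exact: NE Ek.
have U0 : (mu (\bigcup_(k in [set k | (0 <= k)%N]) E k) < +oo)%E.
  by rewrite (le_lt_trans _ fin)// le_measure ?inE//; exact: mU.
move=> /(_ U0) cvg0.
have [N _ NH] : \forall n \near \oo,
    (mu (\bigcup_(k in [set k | (n <= k)%N]) E k) < e%:E)%E.
  apply: (cvg0 [set x | (x < e%:E)%E]); apply: open_nbhs_nbhs; split.
    exact: open_ereal_lt_ereal.
  by rewrite /= lte_fin.
exists N; apply: le_lt_trans (NH N (leqnn N)).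
by rewrite le_measure ?inE// => w Ew; exists N => //=.
Qed.

End eventually_small.

Section semimartingale_transforms.
Context d (T : measurableType d) (R : realType).
Variables (mu : {measure set T -> \bar R}) (F : R -> set (set T)).
Hypotheses (mufin : (mu setT < +oo)%E)
  (sF : forall t, sigma_algebra setT (F t))
  (Fmeas : forall t, F t `<=` measurable)
  (F_nd : forall s t, s <= t -> F s `<=` F t).

Lemma adapted_measurable X t : adapted F X -> 0 <= t -> measurable_fun setT (X t).
Proof. by move=> aX t0; exact: (measurable_wrt_measurable (@Fmeas t) (aX t t0)). Qed.

(* [D] is the event that the localizing time is at most 2. *)
Lemma local_martingale_localized M : local_martingale mu F M ->
  forall e : R, 0 < e -> exists D Y, [/\ measurable D, (mu D < e%:E)%E,
    martingale mu F Y &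
    forall (s t : R) w, 0 <= s <= 2 -> 0 <= t <= 2 -> ~ D w ->
      Y t w - Y s w = M t w - M s w].
Proof.
move=> [_ _ [tau [stau tauy mart]]] e e0.
pose E n := [set w | (tau n w <= 2%:E)%E].
have mE n : measurable (E n) by apply: (@Fmeas 2); apply (stau n).2.
have aeE : \forall w \ae mu, \forall n \near \oo, ~ E n w.
  apply: filterS tauy => w Hw.
  have cvgw : tau n w @[n --> \oo] --> +oo%E by exact: Hw.2.
  near=> n => /=; apply/negP; rewrite -ltNge.
  near: n; exact: cvgey_gt.
have [n En] := ae_eventually_notin_small mufin mE aeE e0.
exists (E n), (stopped (fun t w => M t w - M 0 w) (tau n)); split => //.
have stop t w : t <= 2 -> ~ E n w ->
    stopped (fun t w => M t w - M 0 w) (tau n) t w = M t w - M 0 w.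
  move=> t2 /negP; rewrite /E/= -ltNge => nE; rewrite /stopped min_l//.
  by rewrite (le_trans _ (ltW nE))// lee_fin.
move=> s t w /andP[_ s2] /andP[_ t2] nE; rewrite !stop//; ring.
Unshelve. all: by end_near. Qed.

(** The variation on [[1, 2]] is almost surely finite, hence bounded by some [v] off a small event.
    Only the countably many grid sums enter the events [E v], which makes these measurable. *)
Lemma finite_variation_tight A : finite_variation_process mu F A ->
  forall e : R, 0 < e -> exists W (v : R), [/\ measurable W, (mu W < e%:E)%E, 0 <= v &
    forall n w, ~ W w ->
      \sum_(k < n.+1) `|A (grid n k.+1) w - A (grid n k) w| <= v].
Proof.
move=> [aA bvA] e e0.
pose S n w := \sum_(k < n.+1) `|A (grid n k.+1) w - A (grid n k) w|.
pose E v := \bigcup_n [set w | v%:R < S n w].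
have mS n : measurable_fun setT (S n).
  apply: measurable_sum => k; apply: measurableT_comp => //.
  by apply: measurable_funB; apply: adapted_measurable => //; exact: grid_ge0.
have mE v : measurable (E v).
  apply: bigcup_measurable => n _.
  by rewrite -[X in measurable X]setTI; exact: measurable_fun_ltr.
have aeE : \forall w \ae mu, \forall n \near \oo, ~ E n w.
  apply: filterS bvA => w [_ bvw].
  have [v vub] := bounded_variation_grid (bvw 2 (ler0n _ _)).
  exists (Num.truncn v).+1 => // m /= vm [n _ /=]; apply/negP; rewrite -leNgt.
  rewrite (le_trans (vub n))// (le_trans (ltW (truncnS_gt v)))// ler_nat//.
have [v Ev] := ae_eventually_notin_small mufin mE aeE e0.
exists (E v), v%:R; split => // n w nE; rewrite leNgt; apply/negP => H.
by apply: nE; exists n.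
Qed.

(** Off a small event, the transform of [X] is that of a true martingale [Y] plus a sum against [A]:
    the weak type inequality controls the former, the variation of [A] the latter. *)
Theorem semimartingale_transform_tight X : semimartingale mu F X ->
  forall e : R, 0 < e -> exists2 l : R, 0 < l & forall n (eta : nat -> T -> R) E,
    (forall k, measurable_wrt (F (grid n k)) (eta k)) ->
    (forall k w, `|eta k w| <= 1) -> measurable E ->
    E `<=` [set w | l <= `|transform (fun k => X (grid n k)) eta n.+1 w|] ->
    (mu E < e%:E)%E.
Proof.
move=> [_ [M [A [lM fA XMA]]]] e e0.
(* Three exceptional events [B], [D], [W], each of measure at most [e / 4], and a null set together
   stay strictly below [e]. *)
have e40 : 0 < e / 4 by rewrite divr_gt0.
have [D [Y [mD De [aY iY mY] YM]]] := local_martingale_localized lM e40.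
have [W [v [mW We v0 Wv]]] := finite_variation_tight fA e40.
(* Every grid ends at time 2, so the weak type bound is [2 K / l] for all [n]; the choice of [l]
   below makes it at most [e / 4]. *)
set K := \int[mu]_w `|Y 2 w|.
have K0 : 0 <= K by exact: Rintegral_ge0.
pose l := 8 * (K + 1) / e.
have l0 : 0 < l by rewrite divr_gt0// mulr_gt0// ltr_wpDl.
(* If the whole transform reaches [l + v] and its finite variation part is at most [v], the
   martingale part reaches [l]. *)
exists (l + v); first by rewrite ltr_pwDl.
move=> n eta E aeta eta1 mE sE.
pose Yg k := Y (grid n k).
have iYg k : mu.-integrable setT (EFin \o Yg k) by apply: iY; exact: grid_ge0.
have mYg k B : F (grid n k) B ->
    \int[mu]_(w in B) Yg k.+1 w = \int[mu]_(w in B) Yg k w.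
  move=> FB; have [_ _ H] := mY _ _ (grid_ge0 n k) (ltW (grid_lt n k)).
  by rewrite /Rintegral H.
have aYg k : measurable_wrt (F (grid n k)) (Yg k) by apply: aY; exact: grid_ge0.
have Fg k : F (grid n k) `<=` F (grid n k.+1) by exact/F_nd/ltW/grid_lt.
have := burkholder_weak_type mufin (fun k => sF (grid n k))
  (fun k => @Fmeas (grid n k)) Fg aYg iYg mYg aeta eta1 l0 n.+1.
set B := [set w | _] => muB.
have mN : measurable_fun setT (transform Yg eta n.+1).
  apply: (measurable_wrt_measurable (@Fmeas (grid n n.+1))).
  exact: (@measurable_wrt_transform _ _ _ (fun k => F (grid n k))).
have mB : measurable B.
  rewrite /B -[X in measurable X]setTI; apply: measurable_fun_ler => //.
  exact: measurableT_comp.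
move: XMA => [Z [mZ Z0 sZ]].
have sub : E `<=` ((B `|` D) `|` W) `|` Z.
  move=> w Ew; have := sE _ Ew => /= lv.
  have [Zw|nZ] := pselect (Z w); first by right.
  have [Ww|nW] := pselect (W w); first by left; right.
  have [Dw|nD] := pselect (D w); first by left; left; right.
  left; left; left; rewrite /B/=.
  have {nZ}XE t : 0 <= t -> X t w = M t w + A t w.
    move=> t0; apply: contrapT => H; apply: nZ; apply: sZ => /= H'.
    exact/H/H'.
  have -> : transform Yg eta n.+1 w =
      transform (fun k => X (grid n k)) eta n.+1 w
      - \sum_(k < n.+1) eta k w * (A (grid n k.+1) w - A (grid n k) w).
    rewrite /transform -sumrB; apply: eq_bigr => k _.
    have G j : (j <= n.+1)%N -> 0 <= (grid n j : R) <= 2.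
      by move=> jn; rewrite grid_ge0 grid_le2.
    rewrite !XE ?grid_ge0// /Yg.
    rewrite (YM _ _ _ (G k (ltnW (ltn_ord k))) (G k.+1 (ltn_ord k)) nD).
    by ring.
  have Av : `|\sum_(k < n.+1) eta k w * (A (grid n k.+1) w - A (grid n k) w)| <= v.
    apply: le_trans (Wv n w nW); apply: le_trans (ler_norm_sum _ _ _) _.
    by apply: ler_sum => k _; rewrite normrM ler_piMl.
  by rewrite (le_trans _ (lerB_dist _ _))//; lra.
have mU1 : measurable (B `|` D) by exact: measurableU.
have mU2 : measurable ((B `|` D) `|` W) by exact: measurableU.
have mU3 : measurable (((B `|` D) `|` W) `|` Z) by exact: measurableU.
apply: (@le_lt_trans _ _ (mu (((B `|` D) `|` W) `|` Z))).
  by rewrite le_measure ?inE.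
apply: (@le_lt_trans _ _ (((e / 4)%:E + (e / 4)%:E) + (e / 4)%:E + 0)%E); last first.
  by rewrite adde0 -!EFinD lte_fin; lra.
apply: le_trans (measureU2 mu mU2 mZ) _; apply: leeD; last by rewrite le_eqVlt (introT eqP Z0).
apply: le_trans (measureU2 mu mU1 mW) _; apply: leeD; last exact: ltW.
apply: le_trans (measureU2 mu mB mD) _; apply: leeD; last exact: ltW.
apply: le_trans muB _; rewrite lee_fin /Yg gridnn -/K /l.
rewrite invf_div !mulrA.
have K10 : 0 < K + 1 by rewrite ltr_wpDl.
rewrite mulrAC ler_pdivrMr ?mulr_gt0//; nra.
Qed.

End semimartingale_transforms.

(** * The augmented filtration on the completed probability space *)

Section augmented_filtration.
Context d (T : measurableType d) (R : realType) (P : probability T R).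
Implicit Types F : R -> set (set T).

Lemma sigma_algebra_usual_augmentation F t :
  sigma_algebra setT (usual_augmentation P F t).
Proof. by apply: sigma_algebra_bigcap => u _; exact: smallest_sigma_algebra. Qed.

Lemma usual_augmentationS F s t : s <= t ->
  usual_augmentation P F s `<=` usual_augmentation P F t.
Proof.
move=> st A FA u /=; rewrite in_itv/= andbT => tu.
by apply: FA; rewrite /= in_itv/= andbT (le_lt_trans st).
Qed.

(** The intersection over times after [t] is contained in its member at [t + 1]. That one is
    generated by events of [T] and by negligible sets, the latter being Caratheodory-measurable by
    completeness. *)
Lemma usual_augmentation_measurable (X : R -> {RV P >-> R}) t :
  usual_augmentation P (natural_filtration (fun t => X t : T -> R)) t `<=`
  @measurable _ (caratheodory_type (P^*)%mu).
Proof.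
move=> A /(_ (t + 1)); rewrite /= in_itv/= andbT ltrDl ltr01 => /(_ isT).
apply: smallest_sub; first exact: sigma_algebra_measurable.
move=> B [NB|negB].
  apply: caratheodory_measurable_mu_ext; move: B NB.
  apply: smallest_sub; first exact: sigma_algebra_measurable.
  by move=> _ [s _ [Y mY <-]]; apply: measurable_funP.
apply: measure_is_complete_caratheodory.
have [N [mN PN0 BN]] := negB.
exists N; split => //; first exact: caratheodory_measurable_mu_ext.
by rewrite -PN0; exact: measurable_mu_extE.
Qed.

Let mu := @completed_measure_extension _ T R P.

Let completed_measure_extensionE (A : set T) : measurable A -> mu A = P A.
Proof. by move=> mA; rewrite /mu /completed_measure_extension measurable_mu_extE. Qed.

(** The completed measure agrees with [P] on the events of [T], so tightness descends from the
    completion to [P]. *)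
Theorem semimartingale_natural_transform_tight (X : R -> {RV P >-> R}) :
  let F := usual_augmentation P (natural_filtration (fun t => X t : T -> R)) in
  semimartingale_natural P (fun t => X t : T -> R) ->
  forall e : R, 0 < e -> exists2 l : R, 0 < l &
    forall n (eta : nat -> T -> R) (E : set T),
    (forall k, measurable_wrt (F (grid n k)) (eta k)) ->
    (forall k w, `|eta k w| <= 1) -> measurable E ->
    E `<=` [set w | l <= `|transform (fun k => X (grid n k)) eta n.+1 w|] ->
    (P E < e%:E)%E.
Proof.
move=> F sX e e0.
have muT : (mu setT < +oo)%E.
  by rewrite completed_measure_extensionE// probability_setT ltry.
have sF t : sigma_algebra setT (F t) by exact: sigma_algebra_usual_augmentation.
have F_nd s t : s <= t -> F s `<=` F t by exact: usual_augmentationS.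
have [l l0 H] := semimartingale_transform_tight muT sF
  (@usual_augmentation_measurable X) F_nd sX e0.
exists l => // n eta E aeta eta1 mE EH.
rewrite -completed_measure_extensionE//.
apply: (H n eta E) => //.
exact: caratheodory_measurable_mu_ext.
Qed.

End augmented_filtration.

(** * Gaussian moments *)

Lemma pow4D_le (R : realFieldType) (x y : R) :
  (x + y) ^+ 4 <= 8 * x ^+ 4 + 8 * y ^+ 4.
Proof.
have h1 : (x + y) ^+ 2 <= 2 * (x ^+ 2 + y ^+ 2) by have := sqr_ge0 (x - y); nra.
have := ler_pM (sqr_ge0 _) (sqr_ge0 _) h1 h1.
by have := sqr_ge0 (x ^+ 2 - y ^+ 2); nra.
Qed.

Lemma weighted_sqr_le_pow4 (R : realFieldType) (x s : R) : 0 < s ->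
  2 * x ^+ 2 <= s ^+ 2 + (s ^+ 2)^-1 * x ^+ 4.
Proof.
move=> s0; rewrite -subr_ge0.
have -> : s ^+ 2 + (s ^+ 2)^-1 * x ^+ 4 - 2 * x ^+ 2 =
    (s ^+ 2)^-1 * (s ^+ 2 - x ^+ 2) ^+ 2 by field; rewrite gt_eqF.
by rewrite mulr_ge0 ?sqr_ge0// invr_ge0 sqr_ge0.
Qed.

Lemma center_sqr_le (R : realFieldType) (m x s : R) : 0 < s ->
  m ^+ 2 <= 2 * x ^+ 2 + s ^+ 2 + (s ^+ 2)^-1 * (x - m) ^+ 4.
Proof.
move=> s0; have := weighted_sqr_le_pow4 (x - m) s0.
by have := sqr_ge0 (x + (x - m)); nra.
Qed.

(** Here [I] and [V] stand for the fourth and second moments of a normal law of mean [m] and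
    standard deviation [s], and [J] for its fourth central moment. Both [m^2] and [s^2] are at most
    multiples of [V]. *)
Lemma moment4_arith (R : realFieldType) (I J V m s : R) : 0 < s ->
  I <= 8 * J + 8 * m ^+ 4 -> J <= 60 * s ^+ 4 ->
  m ^+ 2 <= 2 * V + s ^+ 2 + (s ^+ 2)^-1 * J -> s ^+ 2 / 8 <= V ->
  I <= 1500 ^+ 2 * V ^+ 2.
Proof.
move=> s0 IJ Js mV sV.
have s20 : 0 < s ^+ 2 by rewrite exprn_gt0.
have : (s ^+ 2)^-1 * J <= 60 * s ^+ 2.
  by rewrite mulrC ler_pdivrMr// (le_trans Js)// -mulrA -exprD.
move=> sJ.
(* Here [490 = 2 + 61 * 8]; the final constant is [480 * 8^2 + 8 * 490^2 = 1951520], below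
   [1500^2]. *)
have mV' : m ^+ 2 <= 490 * V by lra.
have sV' : s ^+ 2 <= 8 * V by lra.
have := ler_pM (sqr_ge0 _) (sqr_ge0 _) mV' mV'.
have := ler_pM (sqr_ge0 _) (sqr_ge0 _) sV' sV'.
by have := sqr_ge0 V; nra.
Qed.

Section normal_moments.
Context {R : realType}.
Variables m s : R.
Hypothesis s0 : 0 < s.

Notation N := (normal_prob m s).
Notation leb := (@lebesgue_measure R).

Let sN0 : s != 0. Proof. by rewrite gt_eqF. Qed.

(** The density is almost everywhere the Radon-Nikodym derivative of the normal law, so the change
    of variables formula applies. *)
Lemma ge0_integral_normal_prob (f : R -> \bar R) :
  measurable_fun setT f -> (forall x, 0 <= f x)%E ->
  (\int[N]_x f x = \int[leb]_x (f x * (normal_pdf m s x)%:E))%E.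
Proof.
move=> mf f0.
have dom : N `<< leb by exact: normal_prob_dominates.
rewrite -(Radon_Nikodym_SigmaFinite.change_of_variables dom)//.
have fi := Radon_Nikodym_SigmaFinite.f_integrable dom.
have mpdf : measurable_fun setT (EFin \o normal_pdf m s).
  by apply/measurable_EFinP; exact: measurable_normal_pdf.
apply: ae_eq_integral => //.
- by apply: emeasurable_funM => //; exact: measurable_int fi.
- exact: emeasurable_funM.
- apply: ae_eqe_mul2l; apply: integral_ae_eq => //.
  by move=> E _ mE; rewrite -(Radon_Nikodym_SigmaFinite.f_integral dom mE).
Qed.

Lemma normal_peak_double : normal_peak s = 2 * normal_peak (2 * s).
Proof.
rewrite /normal_peak.
have -> : (2 * s) ^+ 2 * pi *+ 2 = 2 ^+ 2 * (s ^+ 2 * pi *+ 2) by ring.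
rewrite [in RHS]sqrtrM ?sqr_ge0// sqrtr_sqr gtr0_norm//.
by rewrite invfM mulrA divff// mul1r.
Qed.

Lemma normal_peak_le : normal_peak s * s <= 2^-1.
Proof.
have pi2 := pi_ge2 R.
have : 2 * s <= Num.sqrt (s ^+ 2 * pi *+ 2).
  rewrite -[leLHS]gtr0_norm ?mulr_gt0// -sqrtr_sqr ler_sqrt ?sqr_ge0//.
    by rewrite exprMn -mulr_natr; have := sqr_ge0 s; nra.
  by rewrite -mulr_natr; exact: mulr_ge0 (mulr_ge0 (sqr_ge0 s) (pi_ge0 R)) (ler0n _ 2).
move=> H; rewrite /normal_peak mulrC ler_pdivrMr; first by lra.
by rewrite (lt_le_trans _ H)// mulr_gt0.
Qed.

(* The comparison with the density of twice the standard deviation dispenses with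
   computing Gaussian integrals. *)
Lemma normal_pdf_center4 x :
  (x - m) ^+ 4 * normal_pdf m s x <= 60 * s ^+ 4 * normal_pdf m (2 * s) x.
Proof.
rewrite !normal_pdfE ?mulf_neq0// normal_peak_double /normal_fun.
set p := normal_peak (2 * s); have p0 : 0 <= p by exact: normal_peak_ge0.
set y := (x - m) ^+ 2 / s ^+ 2.
have y0 : 0 <= y by rewrite divr_ge0 ?sqr_ge0.
have s20 : s ^+ 2 != 0 by rewrite expf_neq0.
(* The part [y / 8] of the exponent belongs to the density of deviation [2 s]; the rest is left to
   absorb [y^2]. *)
have E1 : - (x - m) ^+ 2 / (s ^+ 2 *+ 2) = - (y / 8) + - (3 / 8 * y).
  by rewrite /y -mulr_natr; field.
have E2 : - (x - m) ^+ 2 / ((2 * s) ^+ 2 *+ 2) = - (y / 8).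
  by rewrite /y -mulr_natr exprMn; field.
rewrite E1 E2 expRD.
have E4 : (x - m) ^+ 4 = y ^+ 2 * s ^+ 4 by rewrite /y; field.
rewrite E4.
set a := expR (- (y / 8)); have a0 : 0 <= a by exact: expR_ge0.
(* Squaring [1 + 3 y / 16 <= exp (3 y / 16)] gives the constant [256 / 9 < 30]. Doubling the peak
   then accounts for 60. *)
have : y ^+ 2 * expR (- (3 / 8 * y)) <= 30.
  rewrite expRN ler_pdivrMr ?expR_gt0//.
  have -> : 3 / 8 * y = 3 / 16 * y + 3 / 16 * y by lra.
  rewrite expRD; have := expR_ge1Dx (3 / 16 * y).
  set b := expR _ => b1.
  have b0 : 0 <= 1 + 3 / 16 * y by lra.
  have := ler_pM b0 b0 b1 b1; nra.
set b := expR _ => yb.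
have pas : 0 <= p * a * s ^+ 4 by exact: mulr_ge0 (mulr_ge0 p0 a0) (exprn_even_ge0 _ _).
have := ler_wpM2l pas yb; lra.
Qed.

Lemma normal_center4_le :
  (\int[N]_x ((x - m) ^+ 4)%:E <= (60 * s ^+ 4)%:E)%E.
Proof.
have m4 : measurable_fun setT (fun x : R => (x - m) ^+ 4).
  by apply: measurable_funX; exact: measurable_funB.
rewrite ge0_integral_normal_prob; last 2 first.
- exact/measurable_EFinP.
- by move=> x; rewrite lee_fin exprn_even_ge0.
rewrite -[leRHS]mule1 -(@integral_normal_pdf R m (2 * s)) -ge0_integralZl//; last 3 first.
- by apply/measurable_EFinP; exact: measurable_normal_pdf.
- by move=> x _; rewrite lee_fin normal_pdf_ge0.
- by rewrite lee_fin mulr_ge0// exprn_ge0// ltW.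
apply: ge0_le_integral => //.
- by move=> x _; rewrite -EFinM lee_fin mulr_ge0 ?normal_pdf_ge0// exprn_even_ge0.
- apply: emeasurable_funM; first exact/measurable_EFinP.
  by apply/measurable_EFinP; exact: measurable_normal_pdf.
- apply: emeasurable_funM => //.
  by apply/measurable_EFinP; exact: measurable_normal_pdf.
- by move=> x _; rewrite -!EFinM lee_fin normal_pdf_center4.
Qed.

(** The density is at most its peak, and the interval has length [s]. Whatever the mean, half of the
    mass thus lies at distance at least [s / 2] from 0. *)
Lemma normal_near0_le : (N `](- (s / 2))%R, (s / 2)%R[%classic <= (2^-1)%:E)%E.
Proof.
rewrite /normal_prob.
have mI : measurable (`]- (s / 2), s / 2[%classic : set R) by [].
apply: (@le_trans _ _ (\int[leb]_(x in `](- (s / 2))%R, (s / 2)%R[) (normal_peak s)%:E)%E).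
  apply: ge0_le_integral => //.
  - by move=> x _; rewrite lee_fin normal_pdf_ge0.
  - by apply/measurable_EFinP/measurable_funTS; exact: measurable_normal_pdf.
  - by move=> x _; rewrite lee_fin; exact: normal_pdf_ub.
have ss : - (s / 2) < s / 2 by rewrite gtrN// divr_gt0.
rewrite integral_cst//= lebesgue_measure_itv/= lte_fin ss.
rewrite -EFinB -EFinM lee_fin; apply: le_trans normal_peak_le.
by rewrite opprK -splitr.
Qed.

End normal_moments.

(* [m] is arbitrary; the constant is far from optimal. *)
Lemma normal_moment4 (R : realType) (m s : R) : 0 < s ->
  (normal_prob m s).-integrable setT (EFin \o (fun x : R => x ^+ 4)) /\
  \int[normal_prob m s]_x (x : R) ^+ 4 <= 1500 ^+ 2 * (\int[normal_prob m s]_x (x : R) ^+ 2) ^+ 2.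
Proof.
move=> s0.
have N1 : fine (normal_prob m s setT) = 1 by rewrite /normal_prob integral_normal_pdf.
have Nfin : (normal_prob m s setT < +oo)%E by rewrite /normal_prob integral_normal_pdf ltry.
have mc k : measurable_fun setT (fun x : R => (x - m) ^+ k).
  by apply: measurable_funX; exact: measurable_funB.
have mX k : measurable_fun setT (fun x : R => x ^+ k) by exact: measurable_funX.
have ic4 : (normal_prob m s).-integrable setT (EFin \o (fun x => (x - m) ^+ 4)).
  apply/integrableP; split; first by apply/measurable_EFinP; exact: (mc 4%N).
  under eq_integral do rewrite /= ger0_norm ?exprn_even_ge0//.
  by apply: le_lt_trans (normal_center4_le _ s0) _; rewrite ltry.
have Ic4 : \int[normal_prob m s]_x (x - m) ^+ 4 <= 60 * s ^+ 4.
  rewrite -lee_fin /Rintegral fineK; first exact: normal_center4_le.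
  exact: integrable_fin_num.
have ic c : (normal_prob m s).-integrable setT (EFin \o (fun=> c)) by exact: Rintegrable_cst.
have i4 : (normal_prob m s).-integrable setT (EFin \o (fun x => x ^+ 4)).
  have := @le_Rintegrable _ _ R (normal_prob m s) (fun x : R => x ^+ 4) (fun x : R => 8 * (x - m) ^+ 4 + 8 * m ^+ 4).
  apply => //.
    move=> x; rewrite ger0_norm ?exprn_even_ge0//.
    have -> : x ^+ 4 = ((x - m) + m) ^+ 4 by rewrite subrK.
    move: (x - m) => y.
    exact: pow4D_le.
  by apply: RintegrableD => //; exact: RintegrableZ.
split => //.
have i2 : (normal_prob m s).-integrable setT (EFin \o (fun x => x ^+ 2)).
  have := @le_Rintegrable _ _ R (normal_prob m s) (fun x : R => x ^+ 2) (fun x : R => 1 + x ^+ 4).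
  apply => //.
    move=> x; rewrite ger0_norm ?sqr_ge0//.
    by have := sqr_ge0 (x ^+ 2 - 1); have := sqr_ge0 (x ^+ 2); nra.
  exact: (RintegrableD (ic 1) i4).
set V := \int[normal_prob m s]_x x ^+ 2.
have Icst c : \int[normal_prob m s]_x c = c by rewrite Rintegral_cst// N1 mulr1.
(* Off [A] one has [x^2 >= s^2 / 4], and the complement of [A] has mass at least 1/2. *)
have Vs : s ^+ 2 / 8 <= V.
  pose A := `]- (s / 2), s / 2[%classic : set R.
  have mA : measurable A by exact: measurable_itv.
  have iA : (normal_prob m s).-integrable setT (EFin \o \1_A) by exact: Rintegrable_indic.
  have IA : \int[normal_prob m s]_x \1_A x <= 2^-1.
    rewrite -lee_fin /Rintegral fineK ?integrable_fin_num//.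
    by rewrite integral_indic// setIT normal_near0_le.
  have : \int[normal_prob m s]_x (s ^+ 2 / 4 - s ^+ 2 / 4 * \1_A x) <= V.
    apply: le_Rintegral => //.
      exact: (RintegrableB (ic _) (RintegrableZ _ iA)).
    move=> x _; rewrite indicE; have [xA|] := boolP (x \in A).
      by rewrite mulr1 subrr sqr_ge0.
    rewrite notin_setE /A/= in_itv/= => /negP; rewrite negb_and -!leNgt.
    rewrite mulr0 subr0 => /orP[] H.
      have : 0 <= (- x - s / 2) * (- x + s / 2) by apply: mulr_ge0; lra.
      nra.
    have : 0 <= (x - s / 2) * (x + s / 2) by apply: mulr_ge0; lra.
    nra.
  rewrite (RintegralB measurableT (ic _) (RintegrableZ _ iA)).
  rewrite Icst (RintegralZl (s ^+ 2 / 4) measurableT iA) => H.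
  by have := ler_wpM2l (sqr_ge0 s) IA; lra.
have mV : m ^+ 2 <= 2 * V + s ^+ 2 +
    (s ^+ 2)^-1 * \int[normal_prob m s]_x (x - m) ^+ 4.
  have i2s : (normal_prob m s).-integrable setT
      (EFin \o (fun x : R => 2 * x ^+ 2 + s ^+ 2)).
    by apply: RintegrableD => //; exact: RintegrableZ.
  have i4s := RintegrableZ (s ^+ 2)^-1 ic4.
  rewrite -RintegralZl// -RintegralZl//.
  rewrite -[X in _ + X + _]Icst -RintegralD//; last exact: RintegrableZ.
  rewrite -RintegralD// -[leLHS]Icst.
  apply: le_Rintegral => //; first exact: RintegrableD.
  by move=> x _; exact: center_sqr_le.
apply: moment4_arith s0 _ Ic4 mV Vs.
rewrite -RintegralZl// -[X in _ + X]Icst -RintegralD//; last exact: RintegrableZ.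
apply: le_Rintegral => //.
  by apply: RintegrableD => //; exact: RintegrableZ.
by move=> x _; rewrite -{1}(subrK m x); exact: pow4D_le.
Qed.

Section gaussian_moments.
Context d (T : measurableType d) (R : realType) (P : probability T R).

Let integral_law (nu : {measure set (measurableTypeR R) -> \bar R}) (X : T -> R) (f : R -> R) :
  measurable_fun setT X ->
  (forall A, measurable A -> pushforward P X A = nu A) ->
  measurable_fun setT f -> (forall x, 0 <= f x) ->
  (\int[P]_w (f (X w))%:E = \int[nu]_x (f x)%:E)%E.
Proof.
move=> mX Xnu mf f0.
have mX' : measurable_fun setT (X : T -> measurableTypeR R) by exact: mX.
pose X_mixin := isMeasurableFun.Build _ _ _ (measurableTypeR R) _ mX'.
pose Xm : {mfun T >-> measurableTypeR R} := HB.pack (X : T -> measurableTypeR R) X_mixin.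
rewrite -(@eq_measure_integral _ _ _ setT nu (distribution P Xm)).
  rewrite (@ge0_integral_distribution _ _ _ _ _ P Xm (EFin \o f))//.
  exact/measurable_EFinP.
by move=> A mA _; exact: Xnu.
Qed.

(** The bound transfers from the law of [X]; for a Dirac mass at [m] it only says that [m^4] is at
    most a constant at least 1 times [(m^2)^2]. *)
Lemma gaussian_law_moment4 (X : T -> R) : measurable_fun setT X ->
  gaussian_law (pushforward P X) ->
  P.-integrable setT (EFin \o (fun w => X w ^+ 4)) /\
  \int[P]_w X w ^+ 4 <= 1500 ^+ 2 * (\int[P]_w X w ^+ 2) ^+ 2.
Proof.
move=> mX [m gX].
suff [nu [Xnu [i4 I4]]] : exists nu : {measure set (measurableTypeR R) -> \bar R},
    (forall A, measurable A -> pushforward P X A = nu A) /\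
    nu.-integrable setT (EFin \o (fun x : R => x ^+ 4)) /\
    \int[nu]_x (x : R) ^+ 4 <= 1500 ^+ 2 * (\int[nu]_x (x : R) ^+ 2) ^+ 2.
  have mp k : measurable_fun setT (fun x : R => x ^+ k) by exact: measurable_funX.
  have E4 := integral_law mX Xnu (mp 4%N) (fun x => exprn_even_ge0 (n := 4) x isT).
  have E2 := integral_law mX Xnu (mp 2%N) (fun x => sqr_ge0 x).
  rewrite /Rintegral E2 E4; split => //.
  apply/integrableP; split.
    by apply/measurable_EFinP; exact: measurable_funX.
  under eq_integral do rewrite /= ger0_norm ?exprn_even_ge0//.
  rewrite E4; move/integrableP : i4 => [_].
  by under eq_integral do rewrite /= ger0_norm ?exprn_even_ge0//.
case: gX => [gX|[s s0 gX]]; last first.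
  exists (normal_prob m s); split; first exact: gX.
  exact: normal_moment4.
exists (\d_(m : measurableTypeR R) : {measure set (measurableTypeR R) -> \bar R}); split; first exact: gX.
have mp k : measurable_fun setT (fun x : R => x ^+ k) by exact: measurable_funX.
have E k : (\int[\d_(m : measurableTypeR R)]_x ((x : R) ^+ k)%:E = (m ^+ k)%:E)%E.
  rewrite integral_dirac//; last exact/measurable_EFinP.
  by rewrite diracT mul1e.
split.
  apply/integrableP; split; first exact/measurable_EFinP.
  under eq_integral do rewrite /= ger0_norm ?exprn_even_ge0//.
  by rewrite E ltry.
rewrite /Rintegral !E /= -exprM ler_peMl ?exprn_even_ge0//.
lra.
Qed.

End gaussian_moments.

(** * Covariance of the increments of gfBm *)

Section powR_differences.
Context {R : realType}.

Lemma is_derive_MVT (f df : R -> R) (a b : R) : a < b ->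
  (forall x, a <= x <= b -> is_derive x 1 f (df x)) ->
  exists2 c, a <= c <= b & f b - f a = df c * (b - a).
Proof.
move=> ab dfE.
have [c] : exists2 c, c \in `]a, b[ & f b - f a = df c * (b - a).
  apply: MVT => //.
    by move=> x /[!in_itv]/= /andP[ax xb]; apply: dfE; rewrite !ltW.
  apply: derivable_within_continuous => x /[!in_itv]/= xab.
  by have [] := dfE x xab.
by rewrite in_itv/= => /andP[ac cb] E; exists c => //; rewrite !ltW.
Qed.

(** Two applications of the mean value theorem give [p (p - 1) z^(p - 2) h^2] for some [z >= 1];
    there [|p (p - 1)| <= 2] and [z^(p - 2) <= 1]. *)
Lemma powR_second_difference (p x h : R) : 0 < p -> p < 2 -> 0 < h ->
  1 <= x - h -> `|(x + h) `^ p + (x - h) `^ p - 2 * x `^ p| <= 2 * h ^+ 2.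
Proof.
move=> p0 p2 h0 xh.
pose phi y : R := (y + h) `^ p - y `^ p.
have [y /andP[y1 y2] E1] : exists2 y, x - h <= y <= x &
    phi x - phi (x - h) = p * ((y + h) `^ (p - 1) - y `^ (p - 1)) * (x - (x - h)).
  apply: (@is_derive_MVT phi); first by rewrite gtrBl.
  move=> y /andP[y1 y2]; rewrite mulrBr.
  apply: is_deriveB; last by apply: is_derive1_powR; lra.
  rewrite -[X in is_derive _ _ _ X]mulr1.
  have -> : (fun y => (y + h) `^ p) = (powR (R:=R))^~ p \o (fun y => y + h) by [].
  apply: is_derive1_comp; first by apply: is_derive1_powR; lra.
  rewrite -[X in is_derive _ _ _ X]addr0; apply: is_deriveD.
have yh : y < y + h by lra.
have [z /andP[z1 z2] E2] : exists2 z, y <= z <= y + h &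
    (y + h) `^ (p - 1) - y `^ (p - 1) = (p - 1) * z `^ (p - 1 - 1) * (y + h - y).
  apply: (@is_derive_MVT ((powR (R:=R))^~ (p - 1))) => // z /andP[z1 z2].
  by apply: is_derive1_powR; lra.
have -> : (x + h) `^ p + (x - h) `^ p - 2 * x `^ p = phi x - phi (x - h).
  by rewrite /phi subrK; ring.
rewrite E1 E2; set w := z `^ _.
have w0 : 0 <= w by exact: powR_ge0.
have w1 : w <= 1.
  rewrite /w -[leRHS](powRr0 z); apply: ler_powR; lra.
have -> : p * ((p - 1) * w * (y + h - y)) * (x - (x - h)) =
  (p * (p - 1)) * (w * h ^+ 2) by ring.
rewrite normrM; apply: ler_pM => //.
  by rewrite ler_norml; apply/andP; split; nra.
rewrite ger0_norm; last by rewrite mulr_ge0// sqr_ge0.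
by rewrite ler_piMl// sqr_ge0.
Qed.

End powR_differences.

Section ae_congruence.
Context d (T : measurableType d) (R : realType).
Variable mu : {measure set T -> \bar R}.

Lemma ae_eq_Rintegral (f g : T -> R) : measurable_fun setT f ->
  measurable_fun setT g -> (\forall w \ae mu, f w = g w) ->
  \int[mu]_w f w = \int[mu]_w g w.
Proof.
move=> mf mg fg; rewrite /Rintegral; congr fine.
apply: ae_eq_integral => //; try exact/measurable_EFinP.
by apply: filterS fg => w -> _.
Qed.

Lemma ae_eq_Rintegrable (f g : T -> R) : measurable_fun setT f ->
  (\forall w \ae mu, f w = g w) ->
  mu.-integrable setT (EFin \o g) -> mu.-integrable setT (EFin \o f).
Proof.
move=> mf fg /integrableP[/measurable_EFinP mg ig]; apply/integrableP; split.
  exact/measurable_EFinP.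
rewrite (ae_eq_integral (fun w => `|(EFin \o g) w|%E))//.
- by do 2 apply: measurableT_comp => //.
- by do 2 apply: measurableT_comp => //.
- by apply: filterS fg => w /= -> _.
Qed.

End ae_congruence.

Section gfbm_moments.
Context d (T : measurableType d) (R : realType) (P : probability T R).
Variables (H a b : R) (B Z : R -> {RV P >-> R}).
Hypothesis B_fbm : is_fbm H B.
Hypothesis ZB : forall t : R, 0 <= t ->
  \forall w \ae P, Z t w = a * B t w + b * B (- t) w.

Let g (x : R) := `|x| `^ (2 * H).

Let gN x : g (- x) = g x. Proof. by rewrite /g normrN. Qed.

Let B4 t : P.-integrable setT (EFin \o (fun w => B t w ^+ 4)).
Proof.
have [gB _ _] := B_fbm.
have := gB 1%N (fun=> t) (fun=> 1).
under eq_fun do rewrite big_ord_recl big_ord0 addr0 mul1r.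
by move=> /gaussian_law_moment4 -[].
Qed.

Let BB t s : P.-integrable setT (EFin \o (fun w => B t w * B s w)).
Proof.
by apply: Rintegrable_pow4_mul => //; rewrite [X in (X < _)%E]probability_setT ltry.
Qed.

Let BBE t s : \int[P]_w (B t w * B s w) = 2^-1 * (g s + g t - g (t - s)).
Proof.
have [_ EB] := B_fbm; move=> /(_ t s).
rewrite covariance.unlock !EB /= expectation.unlock => E.
rewrite /Rintegral -[RHS]/(fine (_%:E)) -E; congr fine.
by apply: eq_integral => w _; rewrite /= [in RHS]/GRing.mul /= !subr0.
Qed.

(** The increment of [a B_t + b B_(-t)] from [t] to [t'], put in the form of linear combination to
    which [gaussian_process] applies directly. *)
Let incr (t t' : R) w := \sum_(i < 4)
  nth 0 [:: a; b; - a; - b] i * B (nth 0 [:: t'; - t'; t; - t] i) w.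

Let incrE t t' w :
  incr t t' w = a * B t' w + b * B (- t') w - (a * B t w + b * B (- t) w).
Proof. by rewrite /incr !big_ord_recl big_ord0 /=; ring. Qed.

Let m_incr t t' : measurable_fun setT (incr t t').
Proof.
by apply: measurable_sum => i; exact: measurable_funM.
Qed.

Let incr_moment4 t t' :
  P.-integrable setT (EFin \o (fun w => incr t t' w ^+ 4)) /\
  \int[P]_w incr t t' w ^+ 4 <= 1500 ^+ 2 * (\int[P]_w incr t t' w ^+ 2) ^+ 2.
Proof.
have [gB _ _] := B_fbm; apply: gaussian_law_moment4 => //.
exact: (gB 4%N (fun i => nth 0 [:: t'; - t'; t; - t] i)
  (fun i => nth 0 [:: a; b; - a; - b] i)).
Qed.

(** Bilinearity yields sixteen covariances. The terms [g] of a single time cancel because the four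
    coefficients of an increment sum to 0; pairs of times of equal sign give the first bracket,
    pairs of opposite sign the second. *)
Let incr_product t t' s s' :
  P.-integrable setT (EFin \o (fun w => incr t t' w * incr s s' w)) /\
  \int[P]_w (incr t t' w * incr s s' w) =
  - 2^-1 * ((a ^+ 2 + b ^+ 2) *
      (g (t' - s') - g (t' - s) - g (t - s') + g (t - s)) +
    2 * (a * b) * (g (t' + s') - g (t' + s) - g (t + s') + g (t + s))).
Proof.
pose c (i : 'I_4) := nth 0 [:: a; b; - a; - b] i.
pose x i := B (nth 0 [:: t'; - t'; t; - t] i).
pose y i := B (nth 0 [:: s'; - s'; s; - s] i).
have E w : incr t t' w * incr s s' w =
    \sum_(i < 4) \sum_(j < 4) (c i * c j) * (x i w * y j w).
  rewrite /incr mulr_suml; apply: eq_bigr => i _.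
  by rewrite mulr_sumr; apply: eq_bigr => j _; rewrite /c /x /y; ring.
under eq_fun do rewrite E.
have i1 i j : P.-integrable setT
    (EFin \o (fun w => (c i * c j) * (x i w * y j w))).
  exact/RintegrableZ/BB.
have i2 i : P.-integrable setT
    (EFin \o (fun w => \sum_(j < 4) (c i * c j) * (x i w * y j w))).
  exact: Rintegrable_sum.
split; first exact: Rintegrable_sum.
rewrite Rintegral_sum//.
under eq_bigr do rewrite Rintegral_sum//.
under eq_bigr do under eq_bigr do rewrite (RintegralZl _ measurableT (BB _ _)) BBE.
rewrite !big_ord_recl !big_ord0 /=.
rewrite /c /=.
rewrite !opprK -!opprD !gN.
have gNl u v : g (- u + v) = g (u - v) by rewrite -gN opprD opprK.
by rewrite !gNl; field.
Qed.

Lemma gfbm_increment_moment4 t t' : 0 <= t -> 0 <= t' ->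
  P.-integrable setT (EFin \o (fun w => (Z t' w - Z t w) ^+ 4)) /\
  \int[P]_w (Z t' w - Z t w) ^+ 4 <=
  1500 ^+ 2 * (\int[P]_w (Z t' w - Z t w) ^+ 2) ^+ 2.
Proof.
move=> t0 t'0; have [i4 I4] := incr_moment4 t t'.
have ZE : \forall w \ae P, Z t' w - Z t w = incr t t' w.
  apply: filterS2 (ZB t0) (ZB t'0) => w Zt Zt'.
  by rewrite incrE Zt Zt'.
have mZ k : measurable_fun setT (fun w => (Z t' w - Z t w) ^+ k).
  by apply: measurable_funX; exact: measurable_funB.
have mi k : measurable_fun setT (fun w => incr t t' w ^+ k).
  exact: measurable_funX.
have ZEk k : \forall w \ae P, (Z t' w - Z t w) ^+ k = incr t t' w ^+ k.
  by apply: filterS ZE => w ->.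
split; first exact: ae_eq_Rintegrable i4.
by rewrite (ae_eq_Rintegral (mZ 4%N) (mi 4%N))// (ae_eq_Rintegral (mZ 2%N) (mi 2%N)).
Qed.

Lemma gfbm_increment_product t t' s s' :
  0 <= t -> 0 <= t' -> 0 <= s -> 0 <= s' ->
  P.-integrable setT (EFin \o (fun w => (Z t' w - Z t w) * (Z s' w - Z s w))) /\
  \int[P]_w ((Z t' w - Z t w) * (Z s' w - Z s w)) =
  - 2^-1 * ((a ^+ 2 + b ^+ 2) *
      (g (t' - s') - g (t' - s) - g (t - s') + g (t - s)) +
    2 * (a * b) * (g (t' + s') - g (t' + s) - g (t + s') + g (t + s))).
Proof.
move=> t0 t'0 s0 s'0; have [ip <-] := incr_product t t' s s'.
have ZE u u' : 0 <= u -> 0 <= u' -> \forall w \ae P, Z u' w - Z u w = incr u u' w.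
  move=> u0 u'0; apply: filterS2 (ZB u0) (ZB u'0) => w Zt Zt'.
  by rewrite incrE Zt Zt'.
have ZEE : \forall w \ae P, (Z t' w - Z t w) * (Z s' w - Z s w) =
    incr t t' w * incr s s' w.
  by apply: filterS2 (ZE _ _ t0 t'0) (ZE _ _ s0 s'0) => w -> ->.
have mZ : measurable_fun setT (fun w => (Z t' w - Z t w) * (Z s' w - Z s w)).
  by apply: measurable_funM; exact: measurable_funB.
split; first exact: ae_eq_Rintegrable ip.
by apply: ae_eq_Rintegral => //; exact: measurable_funM.
Qed.

End gfbm_moments.

(** * Variance and adjacent covariance of increments over a short step *)

Section gfbm_estimates.
Context d (T : measurableType d) (R : realType) (P : probability T R).
Variables (H a b : R) (B Z : R -> {RV P >-> R}).
Hypotheses (H_gt0 : 0 < H) (H_lt1 : H < 1) (B_fbm : is_fbm H B).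
Hypothesis ZB : forall t : R, 0 <= t ->
  \forall w \ae P, Z t w = a * B t w + b * B (- t) w.

Let cross_le (x h : R) : 0 < h -> 1 <= x - h ->
  `|a * b * (`|x + h| `^ (2 * H) - `|x| `^ (2 * H) - `|x| `^ (2 * H)
     + `|x - h| `^ (2 * H))| <= (a ^+ 2 + b ^+ 2) * h ^+ 2.
Proof.
move=> h0 xh; have H0 := H_gt0; have H1 := H_lt1.
have xh0 : 0 <= x + h by lra.
have x0 : 0 <= x by lra.
have xh0' : 0 <= x - h by lra.
rewrite (ger0_norm xh0) (ger0_norm x0) (ger0_norm xh0').
have p0 : 0 < 2 * H by lra.
have p2 : 2 * H < 2 by lra.
have := powR_second_difference p0 p2 h0 xh.
set u := _ `^ _; set v := x `^ _; set w := (x - h) `^ _.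
have -> : u + w - 2 * v = u - v - v + w by ring.
move: (u - v - v + w) => y yh.
rewrite normrM (le_trans (ler_wpM2l _ yh))//.
have ab : 2 * `|a * b| <= a ^+ 2 + b ^+ 2.
  have := sqr_ge0 (a - b); have := sqr_ge0 (a + b).
  by case: (ger0P (a * b)) => ? ? ?; nra.
have := ler_wpM2r (sqr_ge0 h) ab; lra.
Qed.

(** The equal-sign bracket produces the main term exactly; the error is the opposite-sign bracket, a
    second difference centered at [2 t + h]. *)
Lemma gfbm_variance_estimate (t h : R) : 1 <= t -> 0 < h ->
  `|\int[P]_w (Z (t + h) w - Z t w) ^+ 2 - (a ^+ 2 + b ^+ 2) * h `^ (2 * H)|
  <= (a ^+ 2 + b ^+ 2) * h ^+ 2.
Proof.
move=> t1 h0; have t0 : 0 <= t by lra.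
have th0 : 0 <= t + h by lra.
under eq_Rintegral do rewrite expr2.
have [_ ->] := gfbm_increment_product B_fbm ZB t0 th0 t0 th0.
have x1 : 1 <= (2 * t + h) - h by lra.
apply: le_trans (cross_le h0 x1).
rewrite !subrr normr0 powR0 ?mulf_neq0 ?gt_eqF//.
have -> : t + h - t = h by ring.
have -> : t - (t + h) = - h by ring.
have -> : t + h + (t + h) = 2 * t + h + h by ring.
have -> : t + h + t = 2 * t + h by ring.
have -> : t + (t + h) = 2 * t + h by ring.
have -> : t + t = 2 * t + h - h by ring.
rewrite normrN (gtr0_norm h0) -[leRHS]normrN.
by rewrite le_eqVlt; apply/orP; left; apply/eqP; congr `|_|; field.
Qed.

(** As for the variance: the equal-sign bracket is now [g (2 h) / 2 - g h], up to the factor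
    [a^2 + b^2], and the second difference is centered at [2 t + 2 h]. *)
Lemma gfbm_covariance_estimate (t h : R) : 1 <= t -> 0 < h ->
  `|\int[P]_w ((Z (t + h) w - Z t w) * (Z (t + h + h) w - Z (t + h) w))
    - (a ^+ 2 + b ^+ 2) * ((2 `^ (2 * H) / 2 - 1) * h `^ (2 * H))|
  <= (a ^+ 2 + b ^+ 2) * h ^+ 2.
Proof.
move=> t1 h0; have t0 : 0 <= t by lra.
have th0 : 0 <= t + h by lra.
have thh0 : 0 <= t + h + h by lra.
have [_ ->] := gfbm_increment_product B_fbm ZB t0 th0 th0 thh0.
have x1 : 1 <= (2 * t + 2 * h) - h by lra.
apply: le_trans (cross_le h0 x1).
have -> : t + h - (t + h + h) = - h by ring.
have -> : t - (t + h + h) = - (2 * h) by ring.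
have -> : t - (t + h) = - h by ring.
have -> : t + h + (t + h + h) = 2 * t + 2 * h + h by ring.
have -> : t + (t + h + h) = 2 * t + 2 * h by ring.
have -> : t + h + (t + h) = 2 * t + 2 * h by ring.
have -> : t + (t + h) = 2 * t + 2 * h - h by ring.
rewrite subrr normr0 powR0 ?mulf_neq0 ?gt_eqF//.
rewrite !normrN (gtr0_norm h0) (@gtr0_norm _ (2 * h)) ?mulr_gt0//.
rewrite powRM ?(ltW h0)// -[leRHS]normrN.
by rewrite le_eqVlt; apply/orP; left; apply/eqP; congr `|_|; field.
Qed.

End gfbm_estimates.

(** * Anticoncentration *)

Lemma sqr_sum_le (R : realFieldType) (n : nat) (y : 'I_n -> R) :
  (\sum_(k < n) y k) ^+ 2 <= n%:R * \sum_(k < n) y k ^+ 2.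
Proof.
rewrite expr2 mulr_suml.
under eq_bigr do rewrite mulr_sumr.
apply: (@le_trans _ _ (\sum_(i < n) \sum_(j < n) (y i ^+ 2 / 2 + y j ^+ 2 / 2))).
  apply: ler_sum => i _; apply: ler_sum => j _.
  by have := sqr_ge0 (y i - y j); nra.
set Q := \sum_(k < n) y k ^+ 2.
rewrite (eq_bigr (fun i => n%:R * (y i ^+ 2 / 2) + Q / 2)) => [|i _]; last first.
  by rewrite big_split/= sumr_const card_ord mulr_natl -mulr_suml.
rewrite big_split/= -mulr_sumr -mulr_suml sumr_const card_ord -[X in _ + X]mulr_natl.
by rewrite -/Q le_eqVlt; apply/orP; left; apply/eqP; field.
Qed.

Section clamp.
Context {R : realFieldType}.

Definition clamp (z : R) := Num.max (-1) (Num.min 1 z).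

Lemma clamp_le1 z : `|clamp z| <= 1.
Proof.
rewrite /clamp ler_norml; apply/andP.
by split; [rewrite le_max lexx|rewrite ge_max ge_min lexx; lra].
Qed.

Lemma clamp_approx z : `|clamp z - z| <= z ^+ 2.
Proof.
rewrite /clamp; have [z1|z1] := lerP 1 z.
  by rewrite max_r; [rewrite ler_norml; apply/andP; split; nra|lra].
have [z2|z2] := lerP (-1) z; last by rewrite ler_norml; apply/andP; split; nra.
by rewrite subrr normr0 sqr_ge0.
Qed.

(** Unclamping [u = x / (L s)] costs at most [u^2 |y|], which completing a square splits into [x^4]
    and [y^2]. The cost is of order [L^-2] against a main term of order [L^-1], so a large [L] makes
    it harmless. *)
Lemma clamp_mul_ge (e x y L s : R) : `|e| <= 1 -> 0 < L -> 0 < s ->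
  e * x * y / (L * s) - (x ^+ 4 / s ^+ 3 + y ^+ 2 / s) / (2 * L ^+ 2) <=
  e * clamp (x / (L * s)) * y.
Proof.
move=> e1 L0 s0; have Ls0 : 0 < L * s by rewrite mulr_gt0.
have := clamp_approx (x / (L * s)); set c := clamp _; set u := x / (L * s) => cu.
have -> : e * x * y / (L * s) = e * u * y by rewrite /u mulrA mulrAC -!mulrA.
have h1 : `|e * (c - u) * y| <= u ^+ 2 * `|y|.
  rewrite !normrM ler_wpM2r// -[leRHS]mul1r.
  by apply: ler_pM.
have h2 : u ^+ 2 * `|y| <= (x ^+ 4 / s ^+ 3 + y ^+ 2 / s) / (2 * L ^+ 2).
  rewrite -(real_normK (num_real y)).
  have -> : (x ^+ 4 / s ^+ 3 + `|y| ^+ 2 / s) / (2 * L ^+ 2) =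
     u ^+ 2 * `|y| + (x ^+ 2 / s - `|y|) ^+ 2 * (s * 2 * L ^+ 2)^-1.
    by rewrite /u; field; rewrite !gt_eqF.
  rewrite lerDl mulr_ge0 ?sqr_ge0// invr_ge0 !mulr_ge0 ?sqr_ge0// ltW//.
have h3 : - (e * (c - u) * y) <= (x ^+ 4 / s ^+ 3 + y ^+ 2 / s) / (2 * L ^+ 2).
  by rewrite (le_trans (ler_norm _))// normrN (le_trans h1).
move: h3; move: (_ / (2 * L ^+ 2)) => K h3.
have : e * (c - u) * y = e * c * y - e * u * y by ring.
by lra.
Qed.

End clamp.

Lemma measurable_clamp d (T : measurableType d) (R : realType) (f : T -> R) :
  measurable_fun setT f -> measurable_fun setT (fun w => clamp (f w)).
Proof.
by move=> mf; apply: measurable_maxr => //; exact: measurable_minr.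
Qed.

(* The scale [2 (C + 2) / |rho|] makes the error due to the clamping at most half
   of the covariance term it perturbs. *)
Definition clamped_past (T : Type) (R : realType) (X : nat -> T -> R) (C s rho : R)
    (k : nat) (w : T) : R :=
  if k is k'.+1
  then Num.sg rho * clamp (X k' w / (2 * (C + 2) / `|rho| * s)) else 0.

Lemma measurable_clamped_past d (T : measurableType d) (R : realType)
    (X : nat -> T -> R) (C s rho : R) (k : nat) :
  measurable_fun setT (X k) -> measurable_fun setT (clamped_past X C s rho k.+1).
Proof.
move=> mX; suff : measurable_fun setT
    (fun w => Num.sg rho * clamp (X k w / (2 * (C + 2) / `|rho| * s))) by [].
by apply: measurable_funM => //; apply: measurable_clamp; exact: measurable_funM.
Qed.

(** * Moments of the clamped sum and the lower bound on its tail *)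

Section anticoncentration.
Context d (T : measurableType d) (R : realType) (P : probability T R).
Variables (X : nat -> T -> R) (C s rho : R).
Hypotheses (C_ge0 : 0 <= C) (s_gt0 : 0 < s) (rho_neq0 : rho != 0)
  (mX : forall k, measurable_fun setT (X k))
  (iX4 : forall k, P.-integrable setT (EFin \o (fun w => X k w ^+ 4)))
  (X4 : forall k, \int[P]_w X k w ^+ 4 <= C * s ^+ 4)
  (X2 : forall k, \int[P]_w X k w ^+ 2 <= 2 * s ^+ 2)
  (XX : forall k, `|rho| / 2 * s ^+ 2 <=
    Num.sg rho * \int[P]_w (X k w * X k.+1 w)).

Let L := 2 * (C + 2) / `|rho|.
Let kappa := `|rho| / (4 * L).

Local Notation past := (clamped_past X C s rho).

Let L0 : 0 < L.
Proof. by rewrite divr_gt0 ?normr_gt0// mulr_gt0// ltr_wpDl. Qed.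

Let kappa0 : 0 < kappa.
Proof. by rewrite divr_gt0 ?normr_gt0// mulr_gt0. Qed.

Lemma clamped_past_le1 k w : `|past k w| <= 1.
Proof.
case: k => [|k] /=; first by rewrite normr0.
by rewrite normrM normr_sg rho_neq0 mul1r clamp_le1.
Qed.

Let mpast k : measurable_fun setT (past k).
Proof.
case: k => [|k]; first exact: measurable_cst.
exact: measurable_clamped_past.
Qed.

Let PT : (P setT < +oo)%E. Proof. by rewrite [X in (X < _)%E]probability_setT ltry. Qed.

Let iXp (j k : nat) : P.-integrable setT (EFin \o (fun w => X j w * X k w)).
Proof.
exact: Rintegrable_pow4_mul.
Qed.

Let iX2 k : P.-integrable setT (EFin \o (fun w => X k w ^+ 2)).
Proof. by under eq_fun do rewrite expr2; exact: iXp. Qed.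

Let iX k : P.-integrable setT (EFin \o X k).
Proof.
apply: (@le_Rintegrable _ _ _ _ _ (fun w => 1 + X k w ^+ 2)) => //.
- move=> w; move: (X k w) => x; rewrite ler_norml.
  have := sqr_ge0 (x + 1); have := sqr_ge0 (x - 1).
  by move=> *; apply/andP; split; nra.
- by apply: RintegrableD => //; exact: Rintegrable_cst.
Qed.

Let Y k w := past k w * X k w.

Let iY k : P.-integrable setT (EFin \o Y k).
Proof. exact: Rintegrable_bounded_mul (mpast k) (clamped_past_le1 k) (iX k). Qed.

(** In [clamp_mul_ge], the main term has mean at least [|rho| s / (2 L)], and the error has mean at
    most [(C + 2) s / (2 L^2) = |rho| s / (4 L)] by the choice of [L]. The difference is
    [kappa s]. *)
Let mean_Y k : kappa * s <= \int[P]_w Y k.+1 w.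
Proof.
have i1 := RintegrableZ (Num.sg rho / (L * s)) (iXp k k.+1).
have i2 := RintegrableZ (s ^+ 3)^-1 (iX4 k).
have i3 := RintegrableZ s^-1 (iX2 k.+1).
have i4 := RintegrableZ (2 * L ^+ 2)^-1 (RintegrableD i2 i3).
have : \int[P]_w (Num.sg rho / (L * s) * (X k w * X k.+1 w) -
    (2 * L ^+ 2)^-1 * ((s ^+ 3)^-1 * X k w ^+ 4 + s^-1 * X k.+1 w ^+ 2)) <=
    \int[P]_w Y k.+1 w.
  apply: le_Rintegral => //; first exact: RintegrableB.
  move=> w _; rewrite /Y /=.
  have e1 : `|Num.sg rho| <= 1 by rewrite normr_sg lern1 leq_b1.
  apply: le_trans (clamp_mul_ge _ _ e1 L0 s_gt0).
  rewrite le_eqVlt; apply/orP; left; apply/eqP.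
  by congr (_ - _); [ring|rewrite mulrC; congr (_ / _); congr (_ + _); exact: mulrC].
rewrite RintegralB// !RintegralZl//; last exact: RintegrableD.
rewrite RintegralD// !RintegralZl//.
move: (X4 k) (X2 k.+1) (XX k) => x4 x2 xx; apply: le_trans.
move: x4 x2 xx; move: (\int[P]_w X k w ^+ 4) (\int[P]_w X k.+1 w ^+ 2)
  (\int[P]_w (X k w * X k.+1 w)) => A4 A2 A1 x4 x2 xx.
have h1 : kappa * s + (2 * L ^+ 2)^-1 * ((s ^+ 3)^-1 * (C * s ^+ 4) +
   s^-1 * (2 * s ^+ 2)) = (L * s)^-1 * (`|rho| / 2 * s ^+ 2).
  rewrite /kappa /L; field.
  by rewrite normr_eq0 rho_neq0 !gt_eqF//; have := C_ge0; lra.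
have h2 : (L * s)^-1 * (`|rho| / 2 * s ^+ 2) <= (L * s)^-1 * (Num.sg rho * A1).
  by apply: ler_wpM2l => //; rewrite invr_ge0 ltW// mulr_gt0.
have h3 : (2 * L ^+ 2)^-1 * ((s ^+ 3)^-1 * A4 + s^-1 * A2) <=
   (2 * L ^+ 2)^-1 * ((s ^+ 3)^-1 * (C * s ^+ 4) + s^-1 * (2 * s ^+ 2)).
  have L2 : 0 < (2 * L ^+ 2)^-1 by rewrite invr_gt0; apply: mulr_gt0 => //; exact: exprn_gt0.
  by rewrite (ler_pM2l L2); apply: lerD; rewrite ler_pM2l ?invr_gt0 ?exprn_gt0.
have -> : Num.sg rho / (L * s) * A1 = (L * s)^-1 * (Num.sg rho * A1).
  by rewrite mulrAC mulrC.
lra.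
Qed.

Let S n w := \sum_(k < n.+1) Y k w.

Let iS n : P.-integrable setT (EFin \o S n).
Proof. exact: Rintegrable_sum. Qed.

Let mS n : measurable_fun setT (S n).
Proof. by apply: measurable_sum => k; exact: measurable_funM. Qed.

Let mean_S n : n%:R * (kappa * s) <= \int[P]_w S n w.
Proof.
(* The term of index 0 has no past and vanishes, hence a factor [n] for [n.+1] summands. *)
rewrite /S Rintegral_sum// big_ord_recl.
have -> : \int[P]_w Y (ord0 : 'I_n.+1) w = 0.
  by rewrite /Y /=; under eq_Rintegral do rewrite mul0r; rewrite /Rintegral integral0.
rewrite add0r mulr_natl -[n in _ *+ n]card_ord -sumr_const.
by apply: ler_sum => k _; exact: mean_Y.
Qed.

Let sqr_S n w : S n w ^+ 2 <= n%:R * \sum_(k < n) X k.+1 w ^+ 2.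
Proof.
rewrite /S big_ord_recl {1}/Y /= mul0r add0r.
apply: le_trans (sqr_sum_le _) _; rewrite ler_wpM2l//.
apply: ler_sum => k _; rewrite /Y exprMn ler_piMl ?sqr_ge0//.
by rewrite -(real_normK (num_real (past _ _))) exprn_ile1// clamped_past_le1.
Qed.

Let iS2 n : P.-integrable setT (EFin \o (fun w => S n w ^+ 2)).
Proof.
apply: (@le_Rintegrable _ _ _ _ _ (fun w => n%:R * \sum_(k < n) X k.+1 w ^+ 2)).
- exact: measurable_funX.
- by move=> w; rewrite ger0_norm ?sqr_ge0// sqr_S.
- by apply: RintegrableZ; apply: Rintegrable_sum.
Qed.

Let mean_S2 n : \int[P]_w S n w ^+ 2 <= n%:R * (n%:R * (2 * s ^+ 2)).
Proof.
have i1 : P.-integrable setT (EFin \o (fun w => \sum_(k < n) X k.+1 w ^+ 2)).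
  exact: Rintegrable_sum.
apply: (@le_trans _ _ (\int[P]_w (n%:R * \sum_(k < n) X k.+1 w ^+ 2))).
  apply: le_Rintegral => //; first exact: RintegrableZ.
rewrite RintegralZl// ler_wpM2l// Rintegral_sum//.
rewrite mulr_natl -[n in _ *+ n]card_ord -sumr_const.
by apply: ler_sum => k _; exact: X2.
Qed.

Theorem clamped_sum_anticoncentration n : (0 < n)%N ->
  let k := rho ^+ 2 / (8 * (C + 2)) in
  exists2 E, measurable E &
    ((k ^+ 2 / 8)%:E <= P E)%E /\
    E `<=` [set w | k * (n%:R * s) / 2 <=
      \sum_(j < n.+1) past j w * X j w].
Proof.
move=> n0 k.
have kE : k = kappa.
  rewrite /k -(real_normK (num_real rho)) /kappa /L; field.
  by rewrite normr_eq0 rho_neq0 gt_eqF//; have := C_ge0; lra.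
pose mu := n%:R * (kappa * s).
pose E := [set w | mu / 2 <= S n w].
have mE : measurable E.
  by rewrite /E -[X in measurable X]setTI; exact: measurable_fun_ler.
exists E => //; split; last first.
  move=> w; rewrite /E /= /mu kE /S /Y => H; apply: le_trans H.
  by rewrite le_eqVlt; apply/orP; left; apply/eqP; ring.
have iE : P.-integrable setT (EFin \o \1_E) by exact: Rintegrable_indic.
have PE : P E = (\int[P]_w \1_E w)%:E.
  by rewrite /Rintegral integral_indic// setIT fineK// fin_num_measure.
rewrite PE lee_fin kE.
have nn : 0 < n%:R :> R by rewrite ltr0n.
(* This value makes [th / 2] times the second moment bound [2 (n s)^2] equal to [mu / 4], leaving
   [mu / 4] of the mean to be carried by [E]. *)
pose th := kappa / (4 * (n%:R * s)).
have th0 : 0 < th by rewrite divr_gt0// !mulr_gt0.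
have i2 := RintegrableZ (th / 2) (iS2 n).
have i3 := RintegrableZ (2 * th)^-1 iE.
have ic : P.-integrable setT (EFin \o (fun=> mu / 2)) by exact: Rintegrable_cst.
have i4 := RintegrableD (RintegrableD ic i2) i3.
have : \int[P]_w S n w <=
    \int[P]_w (mu / 2 + th / 2 * S n w ^+ 2 + (2 * th)^-1 * \1_E w).
  (* Paley-Zygmund: [S <= mu / 2] off [E], and [2 S <= th S^2 + 1 / th] on [E] *)
  apply: le_Rintegral => // w _.
  rewrite indicE; have [wE|wE] := boolP (w \in E); last first.
    move: wE; rewrite notin_setE /E /= => /negP; rewrite -ltNge => H.
    rewrite mulr0 addr0 (le_trans (ltW H))// lerDl mulr_ge0 ?sqr_ge0//.
    by rewrite divr_ge0// ltW.
  have mu0 : 0 <= mu by apply: mulr_ge0 => //; exact: mulr_ge0 (ltW kappa0) (ltW s_gt0).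
  rewrite mulr1 -subr_ge0.
  have -> : mu / 2 + th / 2 * S n w ^+ 2 + (2 * th)^-1 - S n w =
     mu / 2 + (2 * th)^-1 * (th * S n w - 1) ^+ 2.
    by field; rewrite gt_eqF.
  apply: addr_ge0; first exact: divr_ge0.
  by apply: mulr_ge0; rewrite ?sqr_ge0// invr_ge0 mulr_ge0// ltW.
rewrite RintegralD//; last exact: RintegrableD.
rewrite RintegralD// Rintegral_cst// !RintegralZl//.
have -> : fine (P setT) = 1 by rewrite [X in fine X]probability_setT.
have := mean_S n; have := mean_S2 n; rewrite -/mu.
move: (\int[P]_w S n w) (\int[P]_w S n w ^+ 2) (\int[P]_w \1_E w) => A1 A2 p m2 m1 H.
have h1 : th / 2 * A2 <= th / 2 * (n%:R * (n%:R * (2 * s ^+ 2))).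
  by rewrite ler_pM2l// divr_gt0.
have h2 : th / 2 * (n%:R * (n%:R * (2 * s ^+ 2))) = mu / 4.
  by rewrite /th /mu; field; rewrite !gt_eqF.
have h3 : mu / 4 <= (2 * th)^-1 * p by lra.
have h4 : kappa ^+ 2 / 8 = 2 * th * (mu / 4).
  by rewrite /th /mu; field; rewrite !gt_eqF.
have th2 : 0 < 2 * th by rewrite mulr_gt0.
by rewrite h4 -(ler_pdivlMl _ _ th2).
Qed.

End anticoncentration.

(** * Scaling of the mesh *)

Lemma gridS (R : realType) n k : grid n k.+1 = grid n k + n.+1%:R^-1 :> R.
Proof. by rewrite /grid -addrA -natr1 mulrDl mul1r. Qed.

Lemma powR2_neq2 (R : realType) (p : R) : p != 1 -> 2 `^ p != 2 :> R.
Proof.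
apply: contra_neq => /(congr1 (@ln R)).
have ln2 : 0 < ln (2 : R) by rewrite ln_gt0// ltr1n.
rewrite ln_powR -[RHS]mul1r; by apply: mulIf; rewrite gt_eqF.
Qed.

Section mesh_scaling.
Context {R : realType}.
Variable H : R.
Hypothesis H_lt1 : H < 1.

Lemma mesh_powR_ge (M : R) : 0 < M ->
  exists2 n, (0 < n)%N & M <= (n.+1%:R : R) `^ (1 - H).
Proof.
move=> M0; have H1 : 0 < 1 - H by rewrite subr_gt0.
pose y := M `^ (1 - H)^-1.
have y0 : 0 <= y by exact: powR_ge0.
exists (Num.truncn y).+1 => //.
have yn : y <= (Num.truncn y).+2%:R.
  by rewrite (le_trans (ltW (truncnS_gt y)))// ler_nat.
have -> : M = y `^ (1 - H).
  by rewrite /y -powRrM mulVf ?gt_eqF// powRr1// ltW.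
by apply: ge0_ler_powR => //; rewrite ?nnegrE// ltW.
Qed.

(** With mesh [h] and [x = (n + 1)^(1 - H)], increments have deviation of order [h x], so [n] of
    them add up to order [x], which is unbounded. *)
Lemma mesh_powR n : (n.+1%:R^-1 : R) `^ (2 * H) =
  (n.+1%:R^-1 * n.+1%:R `^ (1 - H)) ^+ 2.
Proof.
have n0 : 0 <= n.+1%:R :> R by [].
rewrite -powR_inv1// -powRD; last by apply/implyP; rewrite pnatr_eq0.
rewrite -powRrM -powR_mulrn ?powR_ge0// -powRrM.
by congr (_ `^ _); rewrite -natr1; ring.
Qed.

End mesh_scaling.

Theorem lemma4 (R : realType) (d : measure_display) (T : measurableType d)
    (P : probability T R) (H a b : R) (Z : R -> {RV P >-> R})
    (H_gt0 : 0 < H) (H_lt1 : H < 1) (H_neq : H != 2^-1)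
    (ab_neq0 : (a, b) != (0, 0))
    (Z_gfbm : is_gfbm a b H Z) :
  ~ semimartingale_natural P (fun t : R => Z t : T -> R).
Proof.
have [[B B_fbm ZB] _] := Z_gfbm => sZ.
pose q := a ^+ 2 + b ^+ 2.
have q0 : 0 < q.
  rewrite lt_neqAle addr_ge0 ?sqr_ge0// andbT eq_sym paddr_eq0 ?sqr_ge0//.
  by rewrite !sqrf_eq0 -xpair_eqE.
pose rho := 2 `^ (2 * H) / 2 - 1.
(* The hypothesis [H != 2^-1] enters here: [2^(2 H) = 2] would force [2 H = 1]. *)
have rho0 : rho != 0.
  have : 2 * H != 1.
    by apply: contraNneq H_neq => E; apply/eqP; lra.
  move=> /powR2_neq2; apply: contraNneq => E.
  have : 2 `^ (2 * H) = (rho + 1) * 2 by rewrite /rho subrK divfK.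
  by rewrite E add0r mul1r => ->.
have arho0 : 0 < `|rho| by rewrite normr_gt0.
(* The fourth moment is at most [1500^2] times the square of a second moment bounded by [2 s^2]. *)
pose C : R := 4 * 1500 ^+ 2.
have C0 : 0 <= C by exact: mulr_ge0 (ler0n _ 4) (sqr_ge0 _).
pose k := rho ^+ 2 / (8 * (C + 2)).
have k0 : 0 < k.
  apply: divr_gt0; first by rewrite exprn_even_gt0.
  by apply: mulr_gt0 => //; exact: ltr_wpDl.
have e0 : 0 < k ^+ 2 / 8 by rewrite divr_gt0// exprn_gt0.
have [l l0 tight] := semimartingale_natural_transform_tight sZ e0.
have sq0 : 0 < Num.sqrt q by rewrite sqrtr_gt0.
(* The three summands are lower bounds on [x]: they keep the variance error below [s^2], keep the
   covariance error below [|rho| / 2 * s^2], and bring the anticoncentration threshold above [l]. *)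
pose M := 1 + 2 / `|rho| + 4 * l / (k * Num.sqrt q).
have M1 : 0 <= 2 / `|rho| by rewrite divr_ge0// ltW.
have M2 : 0 <= 4 * l / (k * Num.sqrt q) by rewrite divr_ge0// mulr_ge0// ltW.
have M0 : 0 < M by rewrite /M; lra.
have [n n0] := mesh_powR_ge H_lt1 M0.
have := mesh_powR H n.
set h := n.+1%:R^-1; set x := n.+1%:R `^ (1 - H) => hE xM.
have h0 : 0 < h by rewrite invr_gt0.
have x0 : 0 < x by apply: lt_le_trans xM.
pose s := Num.sqrt q * (h * x).
have s0 : 0 < s by rewrite !mulr_gt0.
have s2 : s ^+ 2 = q * h `^ (2 * H) by rewrite /s exprMn sqr_sqrtr ?ltW// hE.
have s2' : s ^+ 2 = q * h ^+ 2 * x ^+ 2.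
  by rewrite s2 hE exprMn mulrA.
have qh0 : 0 < q * h ^+ 2 by rewrite mulr_gt0// exprn_gt0.
have x1 : 1 <= x by rewrite (le_trans _ xM)// /M; lra.
have qh1 : q * h ^+ 2 <= s ^+ 2.
  by rewrite s2' ler_pMr// expr_ge1// ltW.
have qh2 : q * h ^+ 2 <= `|rho| / 2 * s ^+ 2.
  have rx : 2 <= `|rho| * x.
    by rewrite mulrC -ler_pdivrMr// (le_trans _ xM)// /M; lra.
  have rx2 : 2 <= `|rho| * x ^+ 2.
    by rewrite expr2 mulrA (le_trans rx)// ler_peMr// ltW// mulr_gt0.
  by rewrite s2'; nra.
pose D j w := Z (grid n j.+1) w - Z (grid n j) w.
have DE j : D j = fun w => Z (grid n j + h) w - Z (grid n j) w.
  by apply/funext => w; rewrite /D gridS.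
have mD j : measurable_fun setT (D j) by exact: measurable_funB.
have D4 j := gfbm_increment_moment4 B_fbm ZB (grid_ge0 n j) (grid_ge0 n j.+1).
have D2 j : \int[P]_w D j w ^+ 2 <= 2 * s ^+ 2.
  rewrite DE; have := gfbm_variance_estimate H_gt0 H_lt1 B_fbm ZB (grid_ge1 n j) h0.
  by rewrite -/q -s2 ler_norml => /andP[_]; lra.
have D4' j : \int[P]_w D j w ^+ 4 <= C * s ^+ 4.
  apply: le_trans (D4 j).2 _; rewrite -/(D j).
  have : 0 <= \int[P]_w D j w ^+ 2 by apply: Rintegral_ge0 => w _; exact: sqr_ge0.
  move: (D2 j); rewrite /D; move: (\int[P]_w _) => v v2 v0.
  have := ler_pM v0 v0 v2 v2; rewrite /C; move: (1500 ^+ 2) (sqr_ge0 1500 : (0 : R) <= _).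
  by move=> c c0 H1; have := ler_wpM2l c0 H1; lra.
have DD j : `|rho| / 2 * s ^+ 2 <= Num.sg rho * \int[P]_w (D j w * D j.+1 w).
  have := gfbm_covariance_estimate H_gt0 H_lt1 B_fbm ZB (grid_ge1 n j) h0.
  have -> : \int[P]_w (D j w * D j.+1 w) = \int[P]_w
      ((Z (grid n j + h) w - Z (grid n j) w) *
       (Z (grid n j + h + h) w - Z (grid n j + h) w)).
    by apply: eq_Rintegral => w _; rewrite /D !gridS.
  move: (\int[P]_w _) => A; rewrite -/q -/rho mulrCA -s2 => HA.
  have : `|Num.sg rho * (A - rho * s ^+ 2)| <= `|rho| / 2 * s ^+ 2.
    rewrite normrM normr_sg rho0 mul1r; exact: le_trans HA qh2.
  rewrite ler_norml => /andP[+ _]; have : Num.sg rho * (rho * s ^+ 2) = `|rho| * s ^+ 2 by rewrite mulrA -normrEsg.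
  by rewrite mulrBr; lra.
have [E mE [PE sE]] := clamped_sum_anticoncentration C0 s0 rho0 mD
  (fun j => (D4 j).1) D4' D2 DD n0.
have aZ j : measurable_wrt
    (usual_augmentation P (natural_filtration (fun t => Z t : T -> R)) (grid n j))
    (Z (grid n j)).
  by apply: sZ.1; exact: grid_ge0.
(* Tightness was invoked at exactly the probability that anticoncentration guarantees, whence the
   contradiction. *)
suff : (P E < (k ^+ 2 / 8)%:E)%E by rewrite ltNge PE.
apply: (tight n (clamped_past D C s rho) E) => //.
(* The integrand of index [j.+1] depends on the increment [D j], which is known at the time
   [grid n j.+1]. *)
- move=> j; apply/measurable_wrtP; first exact: sigma_algebra_usual_augmentation.
  case: j => [|j]; first exact: measurable_cst.
  apply: measurable_clamped_past; apply: measurable_funB.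
    apply/measurable_wrtP; first exact: sigma_algebra_usual_augmentation.
    exact: aZ.
  apply/measurable_wrtP; first exact: sigma_algebra_usual_augmentation.
  by apply: measurable_wrtS (aZ j); apply: usual_augmentationS; exact/ltW/grid_lt.
- by move=> j w; exact: clamped_past_le1.
- move=> w /sE /= H1; apply: le_trans (ler_norm _).
  apply: le_trans H1.
  (* Only [n] of the [n.+1] cells contribute, and [n / (n + 1) >= 1 / 2] as [n > 0]. *)
  have nh : 2^-1 <= n%:R * h.
    rewrite /h ler_pdivlMr// -[n.+1%:R]natr1.
    have : 1 <= n%:R :> R by rewrite ler1n.
    by lra.
  have lx : 4 * l <= k * Num.sqrt q * x.
    have kq : 0 < k * Num.sqrt q by exact: mulr_gt0.
    rewrite [leRHS]mulrC -(ler_pdivrMr _ _ kq); apply: le_trans xM.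
    by rewrite /M lerDr addr_ge0.
  rewrite -/k /s; have kq0 : 0 <= k * Num.sqrt q * x.
    by apply: mulr_ge0; [exact: mulr_ge0 (ltW k0) (ltW sq0)|exact: ltW].
  have := ler_wpM2l kq0 nh; lra.
Qed.
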